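(* Let $n>2$, let $\Omega\subset\mathbb{R}^n$ be a bounded open set, let $0\le\theta<1$, let $\alpha,\beta$ be positive constants, and let $a:\Omega\times\mathbb{R}\to\mathbb{R}$ be a Carathéodory function such that $$\frac{\alpha}{(1+|s|)^{\theta}}\le a(x,s)\le\beta\qquad\text{for almost every }x\in\Omega\text{ and every }s\in\mathbb{R}.$$ Let $f\in L^m_{weak}(\Omega)$ with $1<m<(2^* )'$, and let $u$ be an entropy solution of $$-\mathrm{div}\,(a(x,u(x))Du(x))=f(x)\ \text{ in }\Omega,\qquad u=0\ \text{ on }\partial\Omega .$$ Then $u\in L^{m^{**}(1-\theta)}_{weak}(\Omega)$, where $m^{**}=\frac{nm}{n-2m}$.
   Context: Carathéodory function: $a(\cdot,s)$ is measurable for every $s\in\mathbb{R}$ and $a(x,\cdot)$ is continuous for almost every $x\in\Omega$. Exponents: $2^*=\frac{2n}{n-2}$ is the Sobolev exponent and $(2^* )'=\frac{2n}{n+2}$ is its Hölder conjugate. $|E|$ denotes the Lebesgue measure of $E$. Marcinkiewicz space: for an exponent $r>0$, $L^r_{weak}(\Omega)$ is the set of all measurable functions $g$ on $\Omega$ for which there is a constant $\gamma$ such that $|\{x\in\Omega:|g|>\lambda\}|\le\frac{\gamma}{\lambda^r}$ for all $\lambda>0$. Truncation: for $\ell>0$, $T_\ell(v)=\max\{-\ell,\min\{v,\ell\}\}$. Entropy solution: a measurable function $u:\Omega\to\mathbb{R}$ is an entropy solution of the boundary value problem if $T_\ell(u)\in W_0^{1,2}(\Omega)$ for every $\ell>0$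 and $$\int_\Omega a(x,u)\,Du\cdot DT_\ell(u-\varphi)\,dx\le\int_\Omega f\,T_\ell(u-\varphi)\,dx$$ for every $\ell>0$ and every $\varphi\in W_0^{1,2}(\Omega)\cap L^\infty(\Omega)$. Here, as is usual for entropy solutions, $Du$ is the almost everywhere defined measurable vector field with $Du=DT_\ell(u)$ almost everywhere on $\{|u|<\ell\}$ for every $\ell>0$. *)

(* Defs.v *)
From HB Require Import structures.
From mathcomp Require Import all_boot all_order all_algebra.
From mathcomp Require Import all_classical all_reals all_analysis.
Set Implicit Arguments.
Unset Strict Implicit.
Unset Printing Implicit Defensive.
Import Order.TTheory GRing.Theory Num.Theory.
Import numFieldNormedType.Exports.
Local Open Scope classical_set_scope.
Local Open Scope ring_scope.

(* Lebesgue measure on R^n: the n-fold product of the one-dimensional Lebesgue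
   measure, on the product (i.e. Borel) sigma-algebra of [n.-tuple R], is
   transported to ['rV[R]_n] and completed through the Caratheodory
   construction, so that [measurable] means Lebesgue measurable. *)
Section lebesgue_tuple.
Context {R : realType}.

Section step.
Context (n : nat) (mu : {sigma_finite_measure set (n.-tuple R) -> \bar R}).
Local Open Scope ereal_scope.

Let consT (p : R * n.-tuple R) : n.+1.-tuple R := [tuple of p.1 :: p.2].

Lemma measurable_consT : measurable_fun setT consT.
Proof. by apply: measurable_cons. Qed.

Definition lebesgue_cons : set (n.+1.-tuple R) -> \bar R :=
  pushforward ((@lebesgue_measure R) \x mu) consT.

Let lebesgue_cons0 : lebesgue_cons set0 = 0.
Proof. by rewrite /lebesgue_cons /pushforward preimage_set0 measure0. Qed.

Let lebesgue_cons_ge0 A : 0 <= lebesgue_cons A.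
Proof. by rewrite /lebesgue_cons /pushforward; exact: measure_ge0. Qed.

Let lebesgue_cons_sigma_additive : semi_sigma_additive lebesgue_cons.
Proof.
move=> F mF tF mUF; rewrite /lebesgue_cons /pushforward preimage_bigcup.
have mpre A : measurable A -> measurable (consT @^-1` A).
  by move=> mA; rewrite -[X in measurable X]setTI; exact: measurable_consT.
apply: measure_semi_sigma_additive.
- by move=> i; exact: mpre.
- apply/trivIsetP => /= i j _ _ ij; rewrite -preimage_setI.
  by move/trivIsetP : tF => /(_ _ _ _ _ ij) ->//; rewrite preimage_set0.
- by rewrite -preimage_bigcup; exact: mpre.
Qed.

HB.instance Definition _ := isMeasure.Build _ _ _ lebesgue_cons
  lebesgue_cons0 lebesgue_cons_ge0 lebesgue_cons_sigma_additive.

Let lebesgue_cons_sigma_finite : sigma_finite setT lebesgue_cons.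
Proof.
have /sigma_finiteP[F [TF ndF Foo]] :
  sigma_finite setT (@lebesgue_measure R) by exact: sigma_finiteT.
have /sigma_finiteP[G [TG ndG Goo]] := sigma_finiteT mu.
pose unconsT (t : n.+1.-tuple R) := (thead t, [tuple of behead t]).
have munconsT : measurable_fun setT unconsT.
  apply/measurable_fun_pairP; split; first exact: measurable_tnth.
  exact: measurable_behead.
have unconsTK : unconsT \o consT = id.
  by apply/funext => -[x t]; rewrite /unconsT/= theadE; congr pair; exact/val_inj.
exists (fun k => unconsT @^-1` (F k `*` G k)) => [|k].
  rewrite -preimage_bigcup -[LHS](preimage_setT unconsT); congr (_ @^-1` _).
  apply/esym; rewrite -subTset => -[x y] _.
  have [i _ Fix] : (\bigcup_i F i) x by rewrite -TF.
  have [j _ Gjy] : (\bigcup_j G j) y by rewrite -TG.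
  exists (maxn i j) => //; split => /=.
  - by move: x Fix; exact/subsetPset/ndF/leq_maxl.
  - by move: y Gjy; exact/subsetPset/ndG/leq_maxr.
have [mFk Fkoo] := Foo k; have [mGk Gkoo] := Goo k; split.
  by rewrite -[X in measurable X]setTI; apply: munconsT => //; exact: measurableX.
rewrite /lebesgue_cons /pushforward -comp_preimage unconsTK preimage_id.
by rewrite product_measure1E// lte_mul_pinfty// ge0_fin_numE.
Qed.

HB.instance Definition _ := Measure_isSigmaFinite.Build _ _ _ lebesgue_cons
  lebesgue_cons_sigma_finite.

End step.

Fixpoint lebesgue_tuple n : {sigma_finite_measure set (n.-tuple R) -> \bar R} :=
  if n is n'.+1 then lebesgue_cons (lebesgue_tuple n') else \d_[tuple].

End lebesgue_tuple.

Section lebesgue_rV.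
Context {R : realType} (n : nat).
Local Open Scope ereal_scope.

Definition row_of_tuple (t : n.-tuple R) : 'rV[R]_n := \row_i tnth t i.

Definition lebesgue_outer (A : set 'rV[R]_n) : \bar R :=
  mu_ext (@lebesgue_tuple R n) (row_of_tuple @^-1` A).

Let lebesgue_outer0 : lebesgue_outer set0 = 0.
Proof. by rewrite /lebesgue_outer preimage_set0 outer_measure0. Qed.

Let lebesgue_outer_ge0 A : 0 <= lebesgue_outer A.
Proof. exact: outer_measure_ge0. Qed.

Let le_lebesgue_outer : {homo lebesgue_outer : A B / A `<=` B >-> A <= B}.
Proof. by move=> A B AB; apply: le_outer_measure => t; exact: AB. Qed.

Let lebesgue_outer_sigma_subadditive : sigma_subadditive lebesgue_outer.
Proof.
move=> F; rewrite /lebesgue_outer preimage_bigcup.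
exact: outer_measure_sigma_subadditive.
Qed.

HB.instance Definition _ := isOuterMeasure.Build R _ lebesgue_outer
  lebesgue_outer0 lebesgue_outer_ge0 le_lebesgue_outer
  lebesgue_outer_sigma_subadditive.

HB.instance Definition _ :=
  Measurable.copy 'rV[R]_n (caratheodory_type lebesgue_outer).

Definition leb : set 'rV[R]_n -> \bar R := lebesgue_outer.

Let leb0 : leb set0 = 0.
Proof. exact: lebesgue_outer0. Qed.

Let leb_ge0 A : 0 <= leb A.
Proof. exact: lebesgue_outer_ge0. Qed.

Let leb_sigma_additive : semi_sigma_additive leb.
Proof. exact: caratheodory_measure_sigma_additive. Qed.

HB.instance Definition _ := isMeasure.Build _ _ _ leb
  leb0 leb_ge0 leb_sigma_additive.

End lebesgue_rV.
Arguments leb {R n}.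

Section function_spaces.
Context {R : realType} (n : nat) (Omega : set 'rV[R]_n).
Implicit Types (v : 'rV[R]_n -> R) (G : 'rV[R]_n -> 'rV[R]_n).

Definition partial (i : 'I_n) v : 'rV[R]_n -> R := 'D_(delta_mx 0 i) v.

Definition iter_partial (s : seq 'I_n) v : 'rV[R]_n -> R := foldr partial v s.

Definition smooth v := forall s : seq 'I_n,
  continuous (iter_partial s v) /\
  forall (i : 'I_n) x, derivable (iter_partial s v) x (delta_mx 0 i).

Definition closed_support v := closure [set x | v x != 0].

Definition test_function v :=
  [/\ smooth v, compact (closed_support v) & closed_support v `<=` Omega].

Definition L2 v := measurable_fun Omega v /\
  leb.-integrable Omega (fun x => (v x ^+ 2)%:E).

Definition Linfty v := measurable_fun Omega v /\
  exists M : R, {ae leb, forall x, Omega x -> `|v x| <= M}.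

Definition weakL (r : R) v := measurable_fun Omega v /\
  exists gamma : R, forall lambda : R, 0 < lambda ->
    (leb (Omega `&` [set x | (lambda < `|v x|)%R]) <=
     (gamma / lambda `^ r)%:E)%E.

Definition weak_gradient v G := forall phi, test_function phi ->
  forall i : 'I_n,
    (\int[leb]_(x in Omega) (v x * partial i phi x)%:E =
     - \int[leb]_(x in Omega) (G x 0 i * phi x)%:E)%E.

(* v belongs to W^{1,2}(Omega) and G is (a representative of) Dv *)
Definition W12 v G :=
  [/\ L2 v, forall i : 'I_n, L2 (fun x => G x 0 i) & weak_gradient v G].

(* W_0^{1,2}(Omega), the closure of C_c^infty(Omega) in W^{1,2}(Omega) *)
Definition W012 v := exists2 G, W12 v G &
  exists2 phi : nat -> 'rV[R]_n -> R, forall k, test_function (phi k) &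
    (\int[leb]_(x in Omega)
       ((v x - phi k x) ^+ 2 +
        \sum_(i < n) (G x 0 i - partial i (phi k) x) ^+ 2)%:E)%E
      @[k --> \oo] --> 0%E.

End function_spaces.

Definition dotp {R : realType} n (v w : 'rV[R]_n) : R :=
  \sum_(i < n) v 0 i * w 0 i.

Definition truncation {R : realType} (l s : R) : R :=
  Num.max (- l) (Num.min s l).

Section entropy_solutions.
Context {R : realType} (n : nat) (Omega : set 'rV[R]_n).

Definition caratheodory_function (a : 'rV[R]_n -> R -> R) :=
  (forall s, measurable_fun Omega (a ^~ s)) /\
  {ae leb, forall x, Omega x -> continuous (a x)}.

(* Du for a function u all of whose truncations are in W^{1,2}(Omega) *)
Definition generalized_gradient (u : 'rV[R]_n -> R)
    (Du : 'rV[R]_n -> 'rV[R]_n) :=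
  (forall i : 'I_n, measurable_fun Omega (fun x => Du x 0 i)) /\
  forall l : R, 0 < l ->
    forall G, W12 Omega (fun x => truncation l (u x)) G ->
      {ae leb, forall x, Omega x -> `|u x| < l -> Du x = G x}.

(* G ranges over the representatives of DT_l(u - phi); the latter exists since
   T_l(u - phi) = T_l(T_(l + M)(u) - phi) whenever |phi| <= M. *)
Definition entropy_solution (a : 'rV[R]_n -> R -> R) (f u : 'rV[R]_n -> R) :=
  [/\ measurable_fun Omega u,
      forall l : R, 0 < l -> W012 Omega (fun x => truncation l (u x)) &
      exists2 Du, generalized_gradient u Du &
      forall (l : R) phi, 0 < l -> W012 Omega phi -> Linfty Omega phi ->
      forall G, W12 Omega (fun x => truncation l (u x - phi x)) G ->
      (\int[leb]_(x in Omega) (a x (u x) * dotp (Du x) (G x))%:E <=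
       \int[leb]_(x in Omega) (f x * truncation l (u x - phi x))%:E)%E].

End entropy_solutions.

Definition sobolev_exponent_conj {R : realType} (n : nat) : R :=
  2 * n%:R / (n%:R + 2).

Definition mstarstar {R : realType} (n : nat) (m : R) : R :=
  n%:R * m / (n%:R - 2 * m).

(* Main.v *)
(* Testing the equation with T_k(u) bounds the energy of w = T_l(u - T_k(u)) by
   l * int_{|u| >= k} |f|, up to the factor (1 + k + l)^theta / alpha, and weak
   L^m gives int_B |f| <= C |B|^(1 - 1/m).  Since w = T_{k+l}(u) - T_k(u), no chain
   rule is needed to know that w is in W_0^{1,2}; one only needs that the gradient
   of T_k(u) vanishes almost everywhere on {|u| >= k}.

   The Sobolev inequality is replaced by a weak isoperimetric estimate.  For
   h in [0, r]^n, int |w(x + h) - w(x)| <= r * sum_i int |D_i w|.  Averaging over h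
   shows that if r^n is a large multiple of |{|w| >= c l}| then, for some h, at
   least half of the points of {|w| >= l} leave {|w| >= c l} when translated by h,
   so that l |{|w| >= l}| <= C r * sum_i int |D_i w|.  With l = k and r^n
   comparable to |{|u| >= k}| this yields, for k >= 1,
     |{|u| >= 2k}| <= C k^(-(1 - theta)/2) |{|u| >= k}|^q,
     q = 1 + 1/n - 1/(2m) < 1,
   and iterating along k = 2^j gives the decay k^(-s) with
   s (1 - q) = (1 - theta)/2, that is s = m^** (1 - theta). *)
Require Import Defs.
From HB Require Import structures.
From mathcomp Require Import all_boot all_order all_algebra.
From mathcomp Require Import all_classical all_reals all_analysis.
From mathcomp Require Import measurable_realfun ring lra.
Set Implicit Arguments.
Unset Strict Implicit.
Unset Printing Implicit Defensive.
Import Order.TTheory GRing.Theory Num.Theory.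
Import numFieldNormedType.Exports.
Local Open Scope classical_set_scope.
Local Open Scope ring_scope.

(** * Lebesgue measure on tuples *)

(** The constant c in the isoperimetric estimate is harmless: w vanishes where |u| <= k, so {|w| >=
    c l} lies in {|u| >= k} for every c > 0, and c may shrink from 1/2 for test functions to 1/8 for
    W_0^{1,2}.

    The estimate sees only the L^1 norm of the gradient. As that gradient lives on B = {|u| >= k},
    Young's inequality with a free parameter t bounds it by t |B| + int |Dw|^2 / t, and optimising t
    gives the square root of |B| times the energy. With l = k the energy is of order k^(1 + theta)
    |B|^(1 - 1/m), whence a power (1 + theta)/2 of k; dividing by the k on the left leaves -(1 -
    theta)/2.

    Elements of W_0^{1,2} are accessible only as limits of test functions. Hence [W0_approx], which
    approximates a function and its gradient by the same test function; estimates are transferred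
    from test functions with an explicit error. The vanishing of gradients on level sets does need a
    chain rule, but only for one explicit family of cutoffs. *)

Lemma lebesgue_measure_shift (R : realType) (a : R) (A : set R) :
  measurable A -> lebesgue_measure ((fun x => x + a) @^-1` A) = lebesgue_measure A.
Proof.
move=> mA.
have mf : measurable_fun [set: measurableTypeR R] (fun x : measurableTypeR R => x + a :
  measurableTypeR R).
  by apply: measurable_funD => //; exact: measurable_cst.
pose f : {mfun measurableTypeR R >-> measurableTypeR R} := HB.pack (fun x : R => x + a)
  (isMeasurableFun.Build _ _ _ _ _ mf).
apply/esym; apply: (lebesgue_measure_unique
  (mu := pushforward (@lebesgue_measure R) f)) => // _ [[x y]] _ <-.
transitivity (lebesgue_measure `]x - a, y - a]%classic).
  by rewrite !lebesgue_measure_itv/= !lte_fin ltrD2r -!EFinB opprB addrA subrK.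
rewrite /pushforward; congr (lebesgue_measure _).
by apply/seteqP; split => z/=; rewrite !in_itv/= ltrBlDr lerBrDr.
Qed.

Section tuple_translation.
Context {R : realType}.

Definition tuple_shift n (h t : n.-tuple R) : n.-tuple R :=
  [tuple tnth t i + tnth h i | i < n].

Lemma measurable_tuple_shift n (h : n.-tuple R) :
  measurable_fun setT (tuple_shift h).
Proof.
apply/measurable_fun_tnthP => i.
rewrite (_ : _ \o _ = (fun t => tnth t i + tnth h i)).
  by apply: measurable_funD => //; exact: measurable_tnth.
by apply/funext => t /=; rewrite tnth_mktuple.
Qed.

(** Induction on the dimension: [lebesgue_cons] integrates the measures of sections, the inductive
    hypothesis absorbs the shift inside each section, and one-dimensional invariance absorbs the
    shift of the outer variable. *)
Lemma lebesgue_tuple_shift n (h : n.-tuple R) (A : set (n.-tuple R)) :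
  measurable A -> lebesgue_tuple n (tuple_shift h @^-1` A) = lebesgue_tuple n A.
Proof.
elim: n h A => [|n IH] h A mA.
  congr (lebesgue_tuple 0 _); apply/seteqP; split=> t /=;
    by rewrite (tuple0 (tuple_shift h t)) (tuple0 t).
have mc := @measurable_consT R n.
set c := (fun p : R * n.-tuple R => _) in mc.
have mB : measurable (c @^-1` A) by rewrite -[X in measurable X]setTI; exact: mc.
rewrite /= /lebesgue_cons /pushforward -/c.
rewrite -[LHS]/(\int[lebesgue_measure]_x
  (lebesgue_tuple n (xsection (c @^-1` (tuple_shift h @^-1` A)) x)))%E.
rewrite -[RHS]/(\int[lebesgue_measure]_x
  (lebesgue_tuple n (xsection (c @^-1` A) x)))%E.
pose g x := lebesgue_tuple n (xsection (c @^-1` A) x).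
transitivity (\int[@lebesgue_measure R]_x (g (x + thead h)%R))%E.
  apply: eq_integral => x _; rewrite /g.
  rewrite -(IH [tuple of behead h] (xsection (c @^-1` A) (x + thead h)));
    last exact: measurable_xsection.
  congr (lebesgue_tuple n _).
  have key t : c (x + thead h, tuple_shift [tuple of behead h] t) =
    tuple_shift h (c (x, t)).
    apply: eq_from_tnth => i; rewrite tnth_mktuple /c /=.
    case: (unliftP ord0 i) => [j|] ->; last first.
      by rewrite !tnth0 /thead.
    by rewrite !tnthS tnth_mktuple [in RHS](tuple_eta h) tnthS.
  apply/funext => t; apply/propext; rewrite /xsection /preimage /= !in_setE /=.
  by rewrite key.
have mf : measurable_fun [set: measurableTypeR R] (fun x : measurableTypeR R => x +
  thead h : measurableTypeR R).
  by apply: measurable_funD => //; exact: measurable_cst.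
rewrite -[LHS](@ge0_integral_pushforward _ _ _ _ _ _ mf lebesgue_measure setT g) //.
- apply: eq_measure_integral => B mB' _.
  exact: lebesgue_measure_shift.
- exact: measurable_fun_xsection.
Qed.

Lemma measurable_tuple_box n (r : R) :
  measurable [set t : n.-tuple R | forall i, 0 <= tnth t i <= r].
Proof.
rewrite (_ : [set _ | _] =
  \bigcap_(i in [set: 'I_n]) ((fun t => tnth t i) @^-1` `[0, r]%classic)).
  apply: fin_bigcap_measurable => // i _; rewrite -[X in measurable X]setTI.
  by apply: measurable_tnth.
by apply/seteqP; split => t /= H i; have := H i; rewrite /= ?in_itv //; apply.
Qed.

Lemma lebesgue_tuple_box n (r : R) : 0 <= r ->
  lebesgue_tuple n [set t | forall i, 0 <= tnth t i <= r] = (r ^+ n)%:E.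
Proof.
move=> r0; elim: n => [|n IH].
  rewrite /= (_ : [set _ | _] = setT) ?diracT//.
  by apply/seteqP; split => // t _ [].
rewrite /= /lebesgue_cons /pushforward.
set B := _ @^-1` _.
have -> : B = `[0, r]%classic `*` [set t : n.-tuple R | forall i, 0 <= tnth t i <= r].
  apply/seteqP; split => -[x t] /=.
    move=> H; split => /=; first by have := H ord0; rewrite /= in_itv.
    by move=> i; have := H (lift ord0 i); rewrite tnthS.
  rewrite in_itv /= => -[xr H] i.
  by case: (unliftP ord0 i) => [j|] -> //; rewrite tnthS.
rewrite -[LHS]/((lebesgue_measure \x lebesgue_tuple n)%E _) product_measure1E//;
  last exact: measurable_tuple_box.
rewrite IH exprS EFinM; congr (_ * _)%E.
transitivity (lebesgue_measure `[0, r]%classic) => //.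
rewrite lebesgue_measure_itv /= lte_fin oppr0 addr0.
by case: ltP => // r0'; congr EFin; apply/eqP; rewrite eq_le r0 r0'.
Qed.

End tuple_translation.

Section tuple_overlap.
Context {R : realType} (n : nat).
Local Notation m := (@lebesgue_tuple R n).

(* Tonelli on (h, x) |-> 1_Q(h) 1_E(x) 1_E'(x + h), where Q = [0, r]^n. *)
Lemma exists_shift_small_overlap (r e e' : R) (E E' : set (n.-tuple R)) :
  0 < r -> measurable E -> measurable E' ->
  m E = e%:E -> m E' = e'%:E ->
  exists2 h : n.-tuple R, (forall i, 0 <= tnth h i <= r) &
    (m (E `&` tuple_shift h @^-1` E') <= (2 * e * e' / r ^+ n)%:E)%E.
Proof.
move=> r0 mE mE' Ee Ee'.
have e0 : 0 <= e by rewrite -lee_fin -Ee.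
have e'0 : 0 <= e' by rewrite -lee_fin -Ee'.
have rn0 : 0 < r ^+ n by rewrite exprn_gt0.
pose Q := [set t : n.-tuple R | forall i, 0 <= tnth t i <= r].
have mQ : measurable Q by exact: measurable_tuple_box.
pose c := 2 * e * e' / r ^+ n.
(* The averaging argument needs e e' > 0; if one of the sets is null, the zero shift already has a
   null overlap. *)
have [c0|] := eqVneq (e * e') 0.
  exists [tuple 0 | i < n].
    by move=> i; rewrite tnth_mktuple lexx ltW.
  have [E0|E'0] : m E = 0%E \/ m E' = 0%E.
    rewrite Ee Ee'; have/eqP := c0; rewrite mulf_eq0 => /orP[/eqP->|/eqP->];
      by [left|right].
  + apply: (@le_trans _ _ (m E)).
      apply: le_measure; rewrite ?inE//; apply: measurableI => //.
      by rewrite -[X in measurable X]setTI; exact: measurable_tuple_shift.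
    by rewrite E0 lee_fin divr_ge0 ?mulr_ge0// ltW.
  + apply: (@le_trans _ _ (m (tuple_shift [tuple 0 | i < n] @^-1` E'))).
      apply: le_measure; rewrite ?inE//; [apply: measurableI => //|];
      by rewrite -[X in measurable X]setTI; exact: measurable_tuple_shift.
    by rewrite lebesgue_tuple_shift// E'0 lee_fin divr_ge0 ?mulr_ge0// ltW.
move=> c0; have ee'0 : 0 < e * e' by rewrite lt0r c0 mulr_ge0.
(* If every h in Q failed, integrating the overlap over Q would give at least 2 e e', while Tonelli
   gives at most e e'. The factor 2 makes these non-strict bounds contradictory. *)
apply: contrapT => /forall2NP H.
pose add (p : n.-tuple R * n.-tuple R) : n.-tuple R := tuple_shift p.1 p.2.
have madd : measurable_fun setT add.
  apply/measurable_fun_tnthP => i.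
  rewrite (_ : _ \o _ = (fun p => tnth p.2 i + tnth p.1 i)); last first.
    by apply/funext => p /=; rewrite tnth_mktuple.
  by apply: measurable_funD => //;
    apply: (@measurableT_comp _ _ _ _ _ _ (fun t : n.-tuple R => tnth t i)) => //;
    exact: measurable_tnth.
pose S := (Q `*` E) `&` add @^-1` E'.
have mS : measurable S.
  apply: measurableI; first exact: measurableX.
  by rewrite -[X in measurable X]setTI; exact: madd.
have := indic_fubini_tonelli m m mS.
rewrite indic_fubini_tonelli_FE// indic_fubini_tonelli_GE//= => FG.
have SF h : Q h -> xsection S h = E `&` tuple_shift h @^-1` E'.
  move=> Qh; apply/funext => x; apply/propext; rewrite /xsection /= in_setE /S /=.
  by split => [[[_ ?] ?]|[? ?]].
have : (\int[m]_(x in Q) (cst c%:E x) <= \int[m]_x (m (xsection S x)))%E.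
  apply: (@le_trans _ _ (\int[m]_(x in Q) (m (xsection S x)))%E).
    apply: ge0_le_integral => //.
    - by move=> x Qx; rewrite lee_fin /c divr_ge0 ?mulr_ge0// ltW.
    - by apply: measurable_funTS; exact: measurable_fun_xsection.
    - move=> h Qh; rewrite SF//; have [//|/negP] := H h.
      by rewrite -ltNge => /ltW.
  apply: ge0_subset_integral => //; exact: measurable_fun_xsection.
have mQE : m Q = (r ^+ n)%:E by apply: lebesgue_tuple_box; exact: ltW.
have IQ : (\int[m]_(x in Q) (cst c%:E x))%E = (c * r ^+ n)%:E.
  by transitivity (c%:E * m Q)%E; [exact: integral_cst|rewrite mQE].
have IE : (\int[m]_(x in E) (cst e'%:E x))%E = (e' * e)%:E.
  by transitivity (e'%:E * m E)%E; [exact: integral_cst|rewrite Ee].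
rewrite FG IQ.
(* For fixed x in E the relevant h lie in E' - x, which has measure e' by translation invariance. *)
have : (\int[m]_y m (ysection S y) <= \int[m]_(y in E) (cst e'%:E y))%E.
  rewrite [leRHS]integral_mkcond; apply: ge0_le_integral => //.
  - exact: measurable_fun_ysection.
  - by apply/(measurable_restrictT _ _).1 => //; exact: measurable_cst.
  move=> x _; rewrite patchE; case: ifPn => xE.
    rewrite /= -Ee' -(lebesgue_tuple_shift x mE').
    apply: le_measure; rewrite ?inE; first exact: measurable_ysection.
      by rewrite -[X in measurable X]setTI; exact: measurable_tuple_shift.
    move=> h; rewrite /ysection /= in_setE /S /= => -[_].
    rewrite /add /= (_ : tuple_shift h x = tuple_shift x h)//.
    by apply: eq_from_tnth => i; rewrite !tnth_mktuple addrC.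
  rewrite (_ : ysection S x = set0) ?measure0//.
  apply/seteqP; split => // h; rewrite /ysection /= in_setE /S /= => -[[_ Ex] _].
  by move: xE; rewrite notin_setE.
move=> /[swap] /le_trans /[apply].
rewrite IE lee_fin /c divfK ?gt_eqF//.
rewrite -mulrA (mulrC e') => /(_ : _ -> False); apply.
by apply/negP; rewrite -ltNge; lra.
Qed.

End tuple_overlap.

(** * Lebesgue measure on row vectors *)

Lemma ge0_integral_measure_preserving d (T : measurableType d) (R : realType)
    (mu : {measure set T -> \bar R}) (phi : T -> T) (f : T -> \bar R) :
  measurable_fun setT phi ->
  (forall A, measurable A -> mu (phi @^-1` A) = mu A) ->
  measurable_fun setT f -> (forall x, 0 <= f x)%E ->
  (\int[mu]_x f (phi x) = \int[mu]_x f x)%E.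
Proof.
move=> mphi muphi mf f0.
rewrite -[LHS](@ge0_integral_pushforward _ _ _ _ _ _ mphi mu setT f) //.
apply: eq_measure_integral => // A mA _.
exact: muphi.
Qed.

Section lebesgue_rV.
Context {R : realType} (n : nat).
Local Notation pre := (fun A : set 'rV[R]_n => (@row_of_tuple R n) @^-1` A).
Local Notation row_of_tuple := (@row_of_tuple R n).
Local Notation lebesgue_outer := (@lebesgue_outer R n).

(** [lebesgue_outer] is [mu_ext] of the preimage, so splitting X along A amounts to splitting the
    preimage of X along that of A. *)
Lemma rV_measurable (A : set 'rV[R]_n) : measurable (pre A) -> measurable A.
Proof.
move=> mA.
have cA : (mu_ext (@lebesgue_tuple R n)).-caratheodory (pre A).
  by apply: sub_caratheodory; exact: sub_sigma_algebra.
by move=> X; have := cA (pre X).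
Qed.

Arguments rV_measurable [A] _.

Lemma lebE (A : set 'rV[R]_n) :
  measurable (pre A) -> leb A = lebesgue_tuple n (pre A).
Proof. by move=> mA; rewrite /leb /lebesgue_outer measurable_mu_extE. Qed.

(** The sigma-algebra on tuples is generated by the coordinates, so U is written as the countable
    union of the cubes with rational centre and half-side 1/(k+1) that it contains. *)
Lemma measurable_pre_open (U : set 'rV[R]_n) : open U -> measurable (pre U).
Proof.
move=> oU.
pose C (p : 'rV[rat]_n * nat) : set 'rV[R]_n :=
  [set x | forall i, `|x 0 i - ratr (p.1 0 i)| < p.2.+1%:R^-1].
have mC p : measurable (pre (C p)).
  rewrite (_ : _ @^-1` _ = \bigcap_(i in [set: 'I_n]) ((fun t => tnth t i) @^-1`
      (ball (ratr (p.1 0 i) : R) p.2.+1%:R^-1))).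
    apply: fin_bigcap_measurable => // i _; rewrite -[X in measurable X]setTI.
    by apply: measurable_tnth => //; exact: measurable_ball.
  apply/seteqP; split => t /= H i; first by move=> _; have := H i;
    rewrite mxE /ball /= distrC.
  by have := H i Logic.I; rewrite mxE /ball /= distrC.
rewrite (_ : U = \bigcup_(p in [set p | C p `<=` U]) C p).
  rewrite preimage_bigcup bigcup_mkcond; apply: countable_bigcupT_measurable => // p.
  by case: ifPn => // _; exact: mC.
apply/seteqP; split => [x Ux|x [p /= CU Cx]]; last exact: CU.
have /nbhs_ballP[e /= e0 eU] : nbhs x U by exact: open_nbhs_nbhs.
have e20 : 0 < e / 2 by rewrite divr_gt0.
pose k := Num.truncn (e / 2)^-1.
have ke : k.+1%:R^-1 < e / 2.
  rewrite -[ltRHS]invrK ltf_pV2 ?posrE ?ltr0n ?invr_gt0 //.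
  exact: truncnS_gt.
have k0 : (0 : R) < k.+1%:R^-1 by rewrite invr_gt0 ltr0n.
have qP i : exists q : rat, `|x 0 i - ratr q| < k.+1%:R^-1.
  have /rat_in_itvoo[q] : x 0 i - k.+1%:R^-1 < x 0 i + k.+1%:R^-1.
    by rewrite ltrBlDr -addrA ltrDl addr_gt0.
  by rewrite in_itv /= => q12; exists q; rewrite ltr_distlC.
have [q qE] := choice qP.
exists (\row_i q i, k) => /=; last by move=> i /=; rewrite mxE; exact: qE.
move=> y Cy; apply: eU; split => // i j; rewrite ord1 /ball /=.
have := Cy j; rewrite /= mxE => Cyj; have := qE j => qxj.
rewrite (_ : x 0 j - y 0 j = (x 0 j - ratr (q j)) - (y 0 j - ratr (q j))); last by lra.
apply: le_lt_trans (ler_normB _ _) _.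
by rewrite (splitr e); apply: ltrD; [exact: lt_trans qxj ke|exact: lt_trans Cyj ke].
Qed.

Arguments measurable_pre_open [U] _.

Lemma rV_open_measurable (U : set 'rV[R]_n) : open U -> measurable U.
Proof.
move=> oU; exact (rV_measurable (measurable_pre_open oU)).
Qed.

Lemma measurable_pre_closed (U : set 'rV[R]_n) : closed U -> measurable (pre U).
Proof.
move=> cU; rewrite -[U]setCK preimage_setC; apply: measurableC.
exact (measurable_pre_open (closed_openC cU)).
Qed.

Arguments rV_open_measurable [U] _.
Arguments measurable_pre_closed [U] _.

Lemma rV_continuous_measurable (f : 'rV[R]_n -> R) (D : set 'rV[R]_n) :
  continuous f -> measurable_fun D f.
Proof.
move=> cf; suff mf : measurable_fun setT f by apply: measurable_funTS.
apply: (measurability _ (RGenOInfty.measurableE R)) => // _ [_ [a ->] <-].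
rewrite setTI; apply: rV_open_measurable.
by move/continuousP : cf; apply; exact: interval_open.
Qed.

(** Shifting a countable cover preserves the measure of its pieces, which gives one inequality; the
    same with -h gives the other. *)
Lemma lebesgue_outer_shift (h : 'rV[R]_n) (A : set 'rV[R]_n) :
  lebesgue_outer ((fun x : 'rV[R]_n => x + h)%R @^-1` A) = lebesgue_outer A.
Proof.
wlog suff H : h A / (lebesgue_outer ((fun x : 'rV[R]_n => x + h)%R @^-1` A)
  <= lebesgue_outer A)%E.
  apply/eqP; rewrite eq_le H /=.
  have {1}-> : A = (fun x : 'rV[R]_n => x - h)%R @^-1` ((fun x : 'rV[R]_n => x + h)%R
    @^-1` A); last exact: H.
  by apply/seteqP; split => x /=; rewrite subrK.
rewrite /lebesgue_outer /mu_ext; apply: le_ereal_inf => _ [B [mB AB] <-].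
pose t := [tuple h 0 i | i < n].
have tE s : row_of_tuple (tuple_shift t s) = row_of_tuple s + h.
  by apply/rowP => i; rewrite !mxE !tnth_mktuple.
exists (fun k => tuple_shift t @^-1` (B k)); first split.
- by move=> i; rewrite -[X in measurable X]setTI; apply: measurable_tuple_shift => //;
  exact: mB.
- move=> s /=; rewrite /preimage /= -tE => As.
  by have [i _ Bi] := AB _ As; exists i.
- by apply: eq_eseriesr => i _; rewrite lebesgue_tuple_shift.
Qed.

(** A measurable set is one satisfying the Caratheodory criterion, not necessarily a Borel set, so
    the criterion itself is transported by the invariance of the outer measure. *)
Lemma measurable_rV_shift (h : 'rV[R]_n) :
  measurable_fun setT (fun x : 'rV[R]_n => x + h).
Proof.
move=> _ A mA; rewrite setTI.
have cA : (lebesgue_outer).-caratheodory A by exact: mA.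
suff : (lebesgue_outer).-caratheodory ((fun x : 'rV[R]_n => x + h)%R @^-1` A) by [].
move=> X; rewrite -[LHS](lebesgue_outer_shift (- h)) cA.
rewrite -(lebesgue_outer_shift h (_ `&` A)) -(lebesgue_outer_shift h (_ `&` ~` A)).
by congr (lebesgue_outer _ + lebesgue_outer _)%E; apply/seteqP; split => x /=;
  rewrite addrK.
Qed.

Arguments measurable_rV_shift : clear implicits.

Lemma leb_shift (h : 'rV[R]_n) (A : set 'rV[R]_n) :
  leb ((fun x : 'rV[R]_n => x + h)%R @^-1` A) = leb A.
Proof. exact: lebesgue_outer_shift. Qed.

Lemma leb_box_finite (r : R)
  : (leb [set x : 'rV[R]_n | forall i, (`|x 0 i| <= r)%R] < +oo)%E.
Proof.
have [r0|r0] := leP 0 r; last first.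
  (* For r < 0 the box is empty, except in dimension 0, where the condition is vacuous. *)
  rewrite (_ : [set _ | _] = if n == 0%N then setT else set0).
    case: ifPn => [/eqP n0|]; last by rewrite measure0.
    rewrite lebE ?preimage_setT //.
    subst n. by rewrite /= diracT ltry.
  case: ifPn => [/eqP n0|].
    by apply/seteqP; split => // x _ /= i; subst n; case: i.
  rewrite -lt0n => n0; apply/seteqP; split => // x /= /(_ (Ordinal n0)).
  by move=> /(le_trans (normr_ge0 _)); rewrite leNgt r0.
pose h : 'rV[R]_n := \row_i r.
rewrite -(leb_shift (- h)).
have pE : pre ((fun x : 'rV[R]_n => x - h) @^-1` [set x | forall i, `|x 0 i| <= r]) =
    [set t : n.-tuple R | forall i, 0 <= tnth t i <= r + r].
  apply/seteqP; split => t /= H i; have := H i; rewrite !mxE ler_norml; lra.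
rewrite lebE pE; last exact: measurable_tuple_box.
by rewrite lebesgue_tuple_box ?addr_ge0// ltry.
Qed.

Lemma bounded_rV_le (A : set 'rV[R]_n) : bounded_set A ->
  exists2 r : R, 0 <= r & forall x, A x -> forall i, `|x 0 i| <= r.
Proof.
move=> /ex_strict_bound_gt0[r r0 Ar]; exists r; first exact: ltW.
move=> x /Ar /ltW /= xr i; apply: le_trans xr.
rewrite [leRHS]mx_normrE; exact: (le_bigmax _ (fun p : 'I_1 * 'I_n => `|x p.1 p.2|) (0, i)).
Qed.

Lemma bounded_leb_lty (A : set 'rV[R]_n) : bounded_set A -> (leb A < +oo)%E.
Proof.
move=> /bounded_rV_le[r r0 Ar].
apply: le_lt_trans (leb_box_finite r).
exact: le_outer_measure.
Qed.

(** Closedness makes the preimages Borel sets of tuples, on which [leb] is the product measure and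
    the Tonelli argument is available. *)
Lemma exists_rV_shift_small_overlap (r e e' : R) (E E' : set 'rV[R]_n) :
  0 < r -> closed E -> closed E' -> leb E = e%:E -> leb E' = e'%:E ->
  exists2 h : 'rV[R]_n, (forall i, 0 <= h 0 i <= r) &
    (leb (E `&` (fun x : 'rV[R]_n => x + h)%R @^-1` E') <= (2 * e * e' / r ^+ n)%:E)%E.
Proof.
move=> r0 cE cE' Ee Ee'.
have mE := measurable_pre_closed cE; have mE' := measurable_pre_closed cE'.
rewrite lebE// in Ee; rewrite lebE// in Ee'.
have [t t1 t2] := exists_shift_small_overlap r0 mE mE' Ee Ee'.
exists (row_of_tuple t) => [i|]; first by rewrite mxE.
have pE : pre (E `&` (fun x : 'rV[R]_n => x + row_of_tuple t)%R @^-1` E') =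
  pre E `&` tuple_shift t @^-1` (pre E').
  congr (_ `&` _); apply/seteqP; split => s /=; congr E';
    by apply/rowP => i; rewrite !mxE tnth_mktuple.
rewrite lebE pE//; apply: measurableI => //.
by rewrite -[X in measurable X]setTI; exact: measurable_tuple_shift.
Qed.

End lebesgue_rV.

(** * Translation estimates for compactly supported functions *)

Lemma Rintegral_measure_preserving d (T : measurableType d) (R : realType)
    (mu : {measure set T -> \bar R}) (phi : T -> T) (f : T -> R) :
  measurable_fun setT phi ->
  (forall A, measurable A -> mu (phi @^-1` A) = mu A) ->
  measurable_fun setT f -> \int[mu]_x f (phi x) = \int[mu]_x f x.
Proof.
move=> mphi muphi mf; rewrite /Rintegral; congr fine.
have mEf : measurable_fun setT (EFin \o f) by exact/measurable_EFinP.
rewrite integralE [RHS]integralE; congr (_ - _)%E.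
- rewrite -[RHS](ge0_integral_measure_preserving mphi muphi (measurable_funepos mEf))
  //; apply: eq_integral => x _.
  by rewrite !funeposE.
- rewrite -[RHS](ge0_integral_measure_preserving mphi muphi (measurable_funeneg mEf))
  //; apply: eq_integral => x _.
  by rewrite !funenegE.
Qed.

Section bounded_support.
Context {R : realType} (n : nat).
Implicit Types f g : 'rV[R]_n -> R.

(** All such functions are integrable and, unlike test functions in a fixed Omega, they are stable
    under translation. *)
Definition bcfun f := continuous f /\ exists M r : R,
  forall x, `|f x| <= M /\ (f x != 0 -> `|x| <= r).

Lemma closed_ball_rV_measurable (r : R) : measurable [set x : 'rV[R]_n | `|x| <= r].
Proof.
apply: rV_measurable; apply: measurable_pre_closed.
rewrite (_ : [set _ | _] = (fun x : 'rV[R]_n => `|x|) @^-1` [set s | s <= r]) //.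
by apply: preimage_closed; [move=> x _; exact: norm_continuous|exact: closed_le].
Qed.

Lemma closed_ball_rV_finite (r : R) : (leb [set x : 'rV[R]_n | (`|x| <= r)%R] < +oo)%E.
Proof.
apply: bounded_leb_lty; exists r; split; first exact: num_real.
by move=> M rM x /= xr; apply: le_trans xr (ltW rM).
Qed.

Lemma bcfun_integrable f (D : set 'rV[R]_n) : measurable D -> bcfun f ->
  leb.-integrable D (EFin \o f).
Proof.
move=> mD [cf [M [r Mr]]]; apply: (@integrableS _ _ _ _ setT) => //.
have mB := closed_ball_rV_measurable r.
rewrite (_ : EFin \o f = (EFin \o f) \_ [set x : 'rV[R]_n | `|x| <= r]).
  apply/(integrable_mkcond _ mB).
  apply: measurable_bounded_integrable => //; first exact: closed_ball_rV_finite.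
    exact: rV_continuous_measurable.
  exists M; split; first exact: num_real.
  by move=> K MK x _; apply: le_trans (Mr x).1 (ltW MK).
apply/funext => x; rewrite patchE; case: ifPn => //.
rewrite notin_setE /= => xr; congr EFin.
by apply/eqP; apply/negP => /negP fx; apply: xr; exact: (Mr x).2.
Qed.

Lemma bcfunB f g : bcfun f -> bcfun g -> bcfun (fun x => f x - g x).
Proof.
move=> [cf [M [r fM]]] [cg [N [s gN]]]; split.
  by move=> x; exact: cvgB (cf x) (cg x).
exists (M + N), (Num.max r s) => x; split.
  apply: le_trans (ler_normB _ _) _; apply: lerD; [exact: (fM x).1|exact: (gN x).1].
rewrite le_max; have [fx0|fx0] := eqVneq (f x) 0.
  by rewrite fx0 sub0r oppr_eq0 => /(gN x).2 ->; rewrite orbT.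
by rewrite ((fM x).2 fx0).
Qed.

Lemma bcfun_norm f : bcfun f -> bcfun (fun x => `|f x|).
Proof.
move=> [cf [M [r fM]]]; split.
  by move=> x; exact: cvg_norm (cf x).
by exists M, r => x; rewrite normr_id normr_eq0; exact: fM.
Qed.

Lemma bcfun_shift f h : bcfun f -> bcfun (fun x => f (x + h)).
Proof.
move=> [cf [M [r fM]]]; split.
  move=> x; have := cf (x + h).
  apply: (@continuous_comp _ _ _ (fun x : 'rV[R]_n => x + h) f x).
  exact: cvgD (@cvg_id _ _) (cvg_cst _).
exists M, (r + `|h|) => x; split; first exact: (fM _).1.
move=> /(fM _).2 xr; rewrite -[x](addrK h).
by apply: le_trans (ler_normB _ _) _; rewrite lerD2r.
Qed.

Lemma bcfunZ (a : R) f : bcfun f -> bcfun (fun x => a * f x).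
Proof.
move=> [cf [M [r fM]]]; split.
  by move=> x; exact: cvgM (cvg_cst _) (cf x).
exists (`|a| * M), r => x; split.
  by rewrite normrM ler_wpM2l//; exact: (fM x).1.
by rewrite mulf_eq0 negb_or => /andP[_ /(fM x).2].
Qed.

Lemma bcfunM f g (M : R) : continuous g -> (forall x, `|g x| <= M) -> bcfun f ->
  bcfun (fun x => g x * f x).
Proof.
move=> cg gM [cf [N [r fN]]]; split.
  by move=> x; exact: cvgM (cg x) (cf x).
exists (M * N), r => x; split.
  by rewrite normrM ler_pM//; exact: (fN x).1.
by rewrite mulf_eq0 negb_or => /andP[_ /(fN x).2].
Qed.

Lemma Rintegral_rV_shift f h : continuous f -> \int[leb]_x f (x + h) = \int[leb]_x f x.
Proof.
move=> cf; apply: (Rintegral_measure_preserving (measurable_rV_shift h)).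
  by move=> A _; exact: leb_shift.
exact: rV_continuous_measurable.
Qed.

End bounded_support.

(** * First-order expansions along a direction, with uniform remainder *)

Section directional_taylor.
Context {R : realType} (n : nat).
Implicit Types (f g : 'rV[R]_n -> R) (v : 'rV[R]_n).

(** Here f' plays the role of the derivative of f along v. In this form products and compositions
    with C^{1,1} functions are pure algebra, and the uniform remainder can be integrated over a
    bounded support. *)
Definition taylor1 v f f' := exists2 K : R, 0 <= K &
  forall x, [/\ `|f x| <= K, `|f' x| <= K,
    forall t, `|f (x + t *: v) - f x| <= K * `|t| &
    forall t, `|f (x + t *: v) - f x - t * f' x| <= K * t ^+ 2].

Lemma line_mvt v f (x : 'rV[R]_n) (t : R) : (forall y : 'rV[R]_n, derivable f y v) ->
  exists2 c, `|c| <= `|t| & f (x + t *: v) - f x = t * 'D_v f (x + c *: v).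
Proof.
move=> df.
suff H (y : 'rV[R]_n) (s : R) : 0 <= s -> exists2 c, 0 <= c <= s &
    f (y + s *: v) - f y = s * 'D_v f (y + c *: v).
  have [t0|t0] := leP 0 t.
    have [c /andP[c0 ct] ->] := H x t t0; exists c => //.
    by rewrite !ger0_norm.
  have [|c /andP[c0 ct]] := H (x + t *: v) (- t); first by rewrite oppr_ge0 ltW.
  rewrite -!addrA -!scalerDl subrr scale0r addr0 => E; exists (t + c).
    rewrite (ltr0_norm t0) ler0_norm; last by lra.
    lra.
  by rewrite -opprB E mulNr opprK.
move=> s0; pose g (r : R) := f (y + r *: v).
have dg (r : R) : is_derive r (1 : R) g ('D_v f (y + r *: v)).
  have E : (fun h : R => h^-1 *: (g (h *: 1 + r) - g r)) =
           (fun h : R => h^-1 *: (f (h *: v + (y + r *: v)) - f (y + r *: v))).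
    apply/funext => h; rewrite /g; congr (_ *: (f _ - _)).
    by rewrite [h *: 1]mulr1 scalerDl addrCA.
  split; first by rewrite /derivable E; exact: df.
  by rewrite /derive E.
have [|c] := @MVT_segment R g (fun r => 'D_v f (y + r *: v)) 0 s s0 (fun r _ => dg r).
  apply: continuous_subspaceT => r.
  by apply: differentiable_continuous; apply/derivable1_diffP; have [] := dg r.
rewrite in_itv /= => c0 E; exists c => //.
by move: E; rewrite /g scale0r addr0 subr0 mulrC.
Qed.

Lemma taylor1_derivable v f (K : R) : (forall y, derivable f y v) ->
  (forall y, derivable ('D_v f) y v) ->
  (forall x, [/\ `|f x| <= K, `|'D_v f x| <= K & `|'D_v ('D_v f) x| <= K]) ->
  taylor1 v f ('D_v f).
Proof.
move=> df ddf H; exists K; first by have [+ _ _] := H 0; apply: le_trans.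
move=> x; have [Hf Hdf _] := H x; split => // t.
  have [c _ ->] := line_mvt x t df.
  by rewrite normrM mulrC ler_wpM2r//; have [] := H (x + c *: v).
(* The remainder is t times the increment of the derivative between x and x + c v; a second mean
   value step bounds it by K |t| |c| with |c| <= |t|. *)
have [c ct ->] := line_mvt x t df.
rewrite -mulrBr normrM; have [c' _ ->] := line_mvt x c ddf.
rewrite normrM -[t ^+ 2]real_normK ?num_real// expr2 [leRHS]mulrC -mulrA ler_wpM2l//.
by apply: ler_pM => //; have [] := H (x + c' *: v).
Qed.

Lemma taylor1M v f f' g g' : taylor1 v f f' -> taylor1 v g g' ->
  taylor1 v (fun x => f x * g x) (fun x => f' x * g x + f x * g' x).
Proof.
(* One K L for each of the three terms in the expansion of the second-order remainder. *)
move=> [K K0 Hf] [L L0 Hg]; exists (3 * (K * L)); first by rewrite !mulr_ge0.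
move=> x; have [f1 f2 f3 f4] := Hf x; have [g1 g2 g3 g4] := Hg x.
have KL0 : 0 <= K * L by rewrite mulr_ge0.
split.
- rewrite normrM; apply: (@le_trans _ _ (K * L)); [exact: ler_pM|lra].
- apply: le_trans (ler_normD _ _) _; rewrite !normrM.
  apply: (@le_trans _ _ (K * L + K * L)); last lra.
  by apply: lerD; apply: ler_pM.
- move=> t.
  have -> : f (x + t *: v) * g (x + t *: v) - f x * g x =
    f (x + t *: v) * (g (x + t *: v) - g x) + (f (x + t *: v) - f x) * g x by ring.
  apply: le_trans (ler_normD _ _) _; rewrite !normrM.
  apply: (@le_trans _ _ (K * (L * `|t|) + (K * `|t|) * L)).
    by have [? _ _ _] := Hf (x + t *: v); apply: lerD; apply: ler_pM.
  have : 0 <= K * L * `|t| by rewrite mulr_ge0.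
  lra.
- move=> t.
  have -> : f (x + t *: v) * g (x + t *: v) - f x * g x - t * (f' x * g x + f x * g' x) =
    f (x + t *: v) * (g (x + t *: v) - g x - t * g' x) +
    ((f (x + t *: v) - f x) * (t * g' x) +
    (f (x + t *: v) - f x - t * f' x) * g x) by ring.
  apply: le_trans (ler_normD _ _) _; apply: le_trans (lerD (lexx _) (ler_normD _ _)) _.
  rewrite !normrM.
  apply: (@le_trans _ _ (K * (L * t ^+ 2) + ((K * `|t|) * (`|t| * L) + K * t ^+ 2 * L))).
    have [? _ _ _] := Hf (x + t *: v); apply: lerD; first exact: ler_pM.
    by apply: lerD; apply: ler_pM => //; rewrite ?mulr_ge0// ler_wpM2l.
  have -> : (K * `|t|) * (`|t| * L) = K * L * (`|t| ^+ 2) by ring.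
  rewrite real_normK ?num_real//; lra.
Qed.

Lemma taylor1_comp v f f' (psi psi' : R -> R) (C : R) : 0 <= C ->
  (forall s, `|psi s| <= C /\ `|psi' s| <= C) ->
  (forall s s', `|psi s' - psi s| <= C * `|s' - s|) ->
  (forall s s', `|psi s' - psi s - (s' - s) * psi' s| <= C * (s' - s) ^+ 2) ->
  taylor1 v f f' -> taylor1 v (psi \o f) (fun x => psi' (f x) * f' x).
Proof.
(* C bounds the value, C K the derivative and the increments; the remainder costs C (K t)^2 from psi
   and C K t^2 from f. *)
move=> C0 p12 p3 p4 [K K0 Hf]; exists (C + C * K + C * K ^+ 2).
  by rewrite !addr_ge0 ?mulr_ge0.
have CK : 0 <= C * K by rewrite mulr_ge0.
have CK2 : 0 <= C * K ^+ 2 by rewrite mulr_ge0// exprn_ge0.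
move=> x; have [f1 f2 f3 f4] := Hf x; have [p1 p2] := p12 (f x); split => /=.
- by apply: le_trans p1 _; lra.
- by rewrite normrM; apply: (@le_trans _ _ (C * K)); [exact: ler_pM|lra].
- move=> t; apply: le_trans (p3 _ _) _.
  apply: (@le_trans _ _ (C * (K * `|t|))); first by rewrite ler_wpM2l.
  by rewrite mulrA ler_wpM2r//; lra.
- move=> t; set y := x + t *: v.
  have -> : psi (f y) - psi (f x) - t * (psi' (f x) * f' x) =
    (psi (f y) - psi (f x) - (f y - f x) * psi' (f x)) +
    psi' (f x) * (f y - f x - t * f' x) by ring.
  apply: le_trans (ler_normD _ _) _; rewrite normrM.
  apply: (@le_trans _ _ (C * (K * `|t|) ^+ 2 + C * (K * t ^+ 2))).
    apply: lerD; last by apply: ler_pM => //; exact: f4.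
    apply: le_trans (p4 _ _) _; rewrite ler_wpM2l//.
    rewrite -[leLHS]real_normK ?num_real// ler_sqr ?nnegrE ?mulr_ge0//; exact: f3.
  rewrite exprMn real_normK ?num_real//.
  have : 0 <= t ^+ 2 by exact: sqr_ge0.
  nra.
Qed.

End directional_taylor.

Lemma integrable_cst_lty d (T : measurableType d) (R : realType)
    (mu : {measure set T -> \bar R}) (A : set T) (k : R) : measurable A ->
  (mu A < +oo)%E -> mu.-integrable A (EFin \o cst k).
Proof.
move=> mA Afin; apply: measurable_bounded_integrable => //.
exists `|k|; split; first exact: num_real.
by move=> M kM x _ /=; exact: ltW.
Qed.

Section translation_estimates.
Context {R : realType} (n : nat).
Implicit Types (f g : 'rV[R]_n -> R) (v : 'rV[R]_n).

(** For |t| <= 1 the remainder is supported in a ball that does not depend on t, so the pointwise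
    bound K t^2 integrates. *)
Lemma taylor1_remainder v f f' : bcfun f -> bcfun f' -> taylor1 v f f' ->
  exists2 C : R, 0 <= C & forall t : R, `|t| <= 1 ->
    \int[leb]_x `|f (x + t *: v) - f x - t * f' x| <= C * t ^+ 2.
Proof.
move=> bf bf' [K K0 Hf].
have [_ [M [r Mr]]] := bf; have [_ [M' [r' Mr']]] := bf'.
pose rho := Num.max r r' + `|v|.
pose B := [set x : 'rV[R]_n | `|x| <= rho].
have mB : measurable B by exact: closed_ball_rV_measurable.
have Bfin : (leb B < +oo)%E by exact: closed_ball_rV_finite.
exists (K * fine (leb B)); first by rewrite mulr_ge0// fine_ge0.
move=> t t1.
have bF : bcfun (fun x => f (x + t *: v) - f x - t * f' x).
  by apply: bcfunB; [apply: bcfunB => //; exact: bcfun_shift|exact: bcfunZ].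
have bFn := bcfun_norm bF.
have rr (s : R) : (s <= r) || (s <= r') -> s <= rho.
  move=> H; apply: (@le_trans _ _ (Num.max r r')); first by rewrite le_max.
  by rewrite lerDl.
have -> : \int[leb]_x `|f (x + t *: v) - f x - t * f' x| =
  \int[leb]_(x in B) `|f (x + t *: v) - f x - t * f' x|.
  rewrite [RHS]Rintegral_mkcond; apply: eq_Rintegral => x _; rewrite patchE.
  case: ifPn => //; rewrite notin_setE /= => xB.
  have -> : f x = 0.
    by apply/eqP/negP => /negP /(Mr x).2 xr; apply: xB; apply: rr; rewrite xr.
  have -> : f' x = 0.
    by apply/eqP/negP => /negP /(Mr' x).2 xr; apply: xB; apply: rr; rewrite xr orbT.
  have -> : f (x + t *: v) = 0; last by rewrite mulr0 !subr0 normr0.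
  apply/eqP/negP => /negP /(Mr _).2 xr; apply: xB => /=.
  rewrite -[x](addrK (t *: v)); apply: le_trans (ler_normB _ _) _.
  apply: lerD; first by rewrite le_max xr.
  by rewrite normrZ ler_piMl.
rewrite mulrAC; rewrite -(Rintegral_cst leb mB).
apply: le_Rintegral => //.
- exact: bcfun_integrable.
- exact: integrable_cst_lty.
- by move=> x _; have [_ _ _] := Hf x; apply.
Qed.

(** Applied to a product, this is integration by parts. A function and its translate have the same
    integral, so |t int f'| <= C t^2 for all small t. *)
Lemma Rintegral_derivative0 v f f' : bcfun f -> bcfun f' -> taylor1 v f f' ->
  \int[leb]_x f' x = 0.
Proof.
move=> bf bf' tf; have [C C0 HC] := taylor1_remainder bf bf' tf.
apply/eqP; rewrite -normr_eq0; apply/negPn/negP => a0.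
set a := `| _ | in a0; have {}a0 : 0 < a by rewrite lt0r a0 /a normr_ge0.
pose t := Num.min 1 (a / (2 * (C + 1))).
have C10 : 0 < 2 * (C + 1) by lra.
have t0 : 0 < t by rewrite lt_min ltr01 divr_gt0.
have t1 : `|t| <= 1 by rewrite gtr0_norm// ge_min lexx.
have bs : bcfun (fun x => f (x + t *: v)) by exact: bcfun_shift.
have I0 : \int[leb]_x (f (x + t *: v) - f x - t * f' x) = - (t * \int[leb]_x f' x).
  rewrite RintegralB//; [|exact: (bcfun_integrable measurableT (bcfunB bs bf))|
    exact: (bcfun_integrable measurableT (bcfunZ t bf'))].
  rewrite RintegralB//; [|exact: (bcfun_integrable measurableT bs)|
    exact: (bcfun_integrable measurableT bf)].
  rewrite Rintegral_rV_shift; last exact: bf.1.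
  rewrite subrr sub0r RintegralZl//.
  exact: (bcfun_integrable measurableT bf').
have := HC t t1.
have bF : bcfun (fun x => f (x + t *: v) - f x - t * f' x).
  by apply: bcfunB; [apply: bcfunB => //; exact: bcfun_shift|exact: bcfunZ].
have := @le_normr_Rintegral _ _ _ leb setT _ measurableT (bcfun_integrable measurableT bF).
move=> /le_trans /[apply]; rewrite I0 normrN normrM gtr0_norm// -/a => H.
have : t * (2 * (C + 1)) <= a by rewrite -ler_pdivlMr// ge_min lexx orbT.
have : a <= C * t by rewrite -(ler_pM2l t0); apply: le_trans H _; rewrite expr2 mulrCA.
nra.
Qed.

(** A translation by t is made of N translations by t/N, each costing |t/N| int |f'| + C (t/N)^2;
    the accumulated error C t^2 / N tends to 0. *)
Lemma Rintegral_translate_le v f f' : bcfun f -> bcfun f' -> taylor1 v f f' ->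
  forall t : R, \int[leb]_x `|f (x + t *: v) - f x| <= `|t| * \int[leb]_x `|f' x|.
Proof.
move=> bf bf' tf; have [C C0 HC] := taylor1_remainder bf bf' tf.
have bs h : bcfun (fun x => f (x + h)) by exact: bcfun_shift.
have bJ h : bcfun (fun x => `|f (x + h) - f x|) by apply: bcfun_norm; exact: bcfunB.
have small t : `|t| <= 1 -> \int[leb]_x `|f (x + t *: v) - f x| <=
    `|t| * (\int[leb]_x `|f' x|) + C * t ^+ 2.
  move=> t1.
  have bF : bcfun (fun x => f (x + t *: v) - f x - t * f' x).
    by apply: bcfunB; [apply: bcfunB => //; exact: bcfun_shift|exact: bcfunZ].
  have bF1 := bcfunZ `|t| (bcfun_norm bf').
  have iF1 := bcfun_integrable measurableT bF1.
  have iF2 := bcfun_integrable measurableT (bcfun_norm bF).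
  apply: (@le_trans _ _ (\int[leb]_x (`|t| * `|f' x| +
    `|f (x + t *: v) - f x - t * f' x|))).
    apply: le_Rintegral => //.
    - exact: (bcfun_integrable measurableT (bJ (t *: v))).
    - exact: (integrableD measurableT iF1 iF2).
    - move=> x _; rewrite -normrM.
      by rewrite -[X in `|X| <= _](subrK (t * f' x)) addrC; exact: ler_normD.
  rewrite RintegralD// RintegralZl//;
    last exact: (bcfun_integrable measurableT (bcfun_norm bf')).
  by rewrite lerD2l; exact: HC.
have steps t (N : nat) : \int[leb]_x `|f (x + (N%:R * t) *: v) - f x| <=
    N%:R * \int[leb]_x `|f (x + t *: v) - f x|.
  elim: N => [|N IH].
    rewrite !mul0r scale0r; under eq_Rintegral do rewrite addr0 subrr normr0.
    by rewrite Rintegral_cst// mul0r.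
  have bG : bcfun (fun x => `|f (x + t *: v + (N%:R * t) *: v) - f (x + t *: v)|).
    exact: (bcfun_shift (t *: v) (bJ ((N%:R * t) *: v))).
  have iG := bcfun_integrable measurableT bG.
  have iJ := bcfun_integrable measurableT (bJ (t *: v)).
  apply: (@le_trans _ _ (\int[leb]_x (`|f (x + t *: v + (N%:R * t) *: v) - f (x + t *: v)| +
     `|f (x + t *: v) - f x|))).
    apply: le_Rintegral => //.
    - exact: (bcfun_integrable measurableT (bJ _)).
    - exact: (integrableD measurableT iG iJ).
    - move=> x _; rewrite -natr1 mulrDl mul1r scalerDl addrA (addrAC x).
      by apply: le_trans (ler_normD _ _); rewrite addrA subrK.
  rewrite RintegralD// -natr1 mulrDl mul1r lerD2r; apply: le_trans IH.
  by rewrite (Rintegral_rV_shift (f := fun x => `|f (x + (N%:R * t) *: v) - f x|)) //;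
    exact: (bJ _).1.
move=> t; apply/ler_addgt0Pr => e e0.
(* N exceeds |t|, so that |t/N| <= 1, and C t^2 / e, so that the accumulated error is at most e. *)
pose N := (Num.truncn (Num.max `|t| (C * t ^+ 2 / e))).+1.
have NM : Num.max `|t| (C * t ^+ 2 / e) < N%:R by exact: truncnS_gt.
have N0 : (0 : R) < N%:R by rewrite ltr0n.
move: NM; rewrite gt_max => /andP[Nt Ne].
have := steps (t / N%:R) N; rewrite mulrCA divff ?gt_eqF// mulr1 => /le_trans; apply.
apply: (@le_trans _ _ (N%:R * (`|t / N%:R| * (\int[leb]_x `|f' x|) + C * (t / N%:R) ^+ 2))).
  rewrite ler_wpM2l ?ler0n//; apply: small.
  by rewrite normrM normfV (gtr0_norm N0) ler_pdivrMr// mul1r ltW.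
rewrite mulrDr; apply: lerD.
  by rewrite normrM normfV (gtr0_norm N0) mulrA mulrCA divff ?gt_eqF// mulr1.
have -> : N%:R * (C * (t / N%:R) ^+ 2) = C * t ^+ 2 / N%:R.
  by field; rewrite gt_eqF.
by rewrite ler_pdivrMr// [leRHS]mulrC -ler_pdivrMr// ltW.
Qed.

End translation_estimates.

(** * Translation and superlevel estimates for test functions *)

Section test_functions.
Context {R : realType} (n : nat) (Omega : set 'rV[R]_n).
Implicit Types (phi : 'rV[R]_n -> R).

Lemma test_function_support phi x : test_function Omega phi -> phi x != 0 -> Omega x.
Proof. by move=> [_ _ sO] px; apply: sO; exact: subset_closure. Qed.

Lemma test_function_bcfun phi : test_function Omega phi -> bcfun phi.
Proof.
move=> [/(_ [::])[/= cphi _] cS _]; split => //.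
have [r r0 Sr] := ex_strict_bound_gt0 (compact_bounded cS).
have [M M0 SM] := ex_strict_bound_gt0
  (compact_bounded (continuous_compact (continuous_subspaceT cphi) cS)).
exists M, r => x; split; last by move=> px; apply/ltW/Sr; exact: subset_closure.
have [->|px] := eqVneq (phi x) 0; first by rewrite normr0 ltW.
by apply/ltW/SM; exists x => //; exact: subset_closure.
Qed.

Lemma test_function_partial i phi : test_function Omega phi ->
  test_function Omega (partial i phi).
Proof.
move=> [sphi cS sO].
(* phi vanishes on the open complement of its closed support, so there the difference quotients are
   eventually 0. *)
have SS : closed_support (partial i phi) `<=` closed_support phi.
  rewrite [X in _ `<=` X](closure_id _).1; last exact: closed_closure.
  apply: closureS => x /= px; apply: contrapT => nx.
  move/eqP : px; apply; rewrite /partial /derive.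
  have oS : open (~` closed_support phi) by apply: closed_openC; exact: closed_closure.
  have phi0 y : (~` closed_support phi) y -> phi y = 0.
    by move=> Sy; apply/eqP/negP => /negP py; apply: Sy; exact: subset_closure.
  apply: cvg_lim => //; apply: cvg_near_cst.
  have : \forall h \near (0:R), (~` closed_support phi) (h *: delta_mx 0 i + x).
    have ch : {for (0 : R), continuous (fun h : R => h *: delta_mx 0 i + x : 'rV[R]_n)}.
      apply: (@continuousD _ _ _ (fun h : R => h *: delta_mx 0 i) (cst x)).
        exact: scalel_continuous.
      exact: cst_continuous.
    apply: ch; rewrite scale0r add0r; exact: open_nbhs_nbhs.
  move=> H; apply: nbhs_dnbhs; near=> h; rewrite /= (phi0 x nx) phi0 ?subrr ?scaler0//.
  by near: h.
split.
- move=> s; have [c d] := sphi (rcons s i).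
  by rewrite /iter_partial foldr_rcons in c d.
- apply: subclosed_compact cS SS; exact: closed_closure.
- exact: subset_trans SS sO.
Unshelve. all: by end_near. Qed.

Lemma test_function_taylor1 i phi : test_function Omega phi ->
  taylor1 (delta_mx 0 i) phi (partial i phi).
Proof.
move=> tp; have tp' := test_function_partial i tp.
have tp'' := test_function_partial i tp'.
have [_ [K0 [r0 HK0]]] := test_function_bcfun tp.
have [_ [K1 [r1 HK1]]] := test_function_bcfun tp'.
have [_ [K2 [r2 HK2]]] := test_function_bcfun tp''.
have [/(_ [::])[_ d0] _ _] := tp; have [/(_ [::])[_ d1] _ _] := tp'.
apply: (@taylor1_derivable _ _ _ _ (Num.max K0 (Num.max K1 K2))).
- by move=> y; exact: d0.
- by move=> y; exact: d1.
- move=> x; rewrite !le_max (HK0 x).1; split => //.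
    by rewrite (HK1 x).1 orbT.
  by rewrite (HK2 x).1 !orbT.
Qed.

(** The displacement is made one coordinate at a time; each increment starts at a point already
    displaced by k, which translation invariance of the integral undoes. *)
Lemma test_function_translate phi (h : 'rV[R]_n) : test_function Omega phi ->
  \int[leb]_x `|phi (x + h) - phi x| <=
  \sum_(i < n) `|h 0 i| * \int[leb]_x `|partial i phi x|.
Proof.
move=> tp; rewrite {1}[h]row_sum_delta.
have bp := test_function_bcfun tp; have bs k := bcfun_shift k bp.
have bJ k : bcfun (fun x => `|phi (x + k) - phi x|) by apply: bcfun_norm; exact: bcfunB.
elim: (index_enum _) => [|i s IH].
  rewrite !big_nil; under eq_Rintegral do rewrite addr0 subrr normr0.
  by rewrite Rintegral_cst// mul0r.
rewrite !big_cons; set k := \sum_(j <- s) _ in IH *.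
pose a := h 0 i *: (delta_mx 0 i : 'rV[R]_n).
have bG : bcfun (fun x => `|phi (x + k + a) - phi (x + k)|).
  exact: (bcfun_shift k (bJ a)).
have iG := bcfun_integrable measurableT bG.
have iJ := bcfun_integrable measurableT (bJ k).
apply: (@le_trans _ _ (\int[leb]_x (`|phi (x + k + a) - phi (x + k)| + `|phi (x + k)
  - phi x|))).
  apply: le_Rintegral => //.
  - exact: (bcfun_integrable measurableT (bJ _)).
  - exact: (integrableD measurableT iG iJ).
  - move=> x _; rewrite -/a (addrC a) addrA.
    by apply: le_trans (ler_normD _ _); rewrite addrA subrK.
rewrite RintegralD//; apply: lerD; last exact: IH.
rewrite (Rintegral_rV_shift (f := fun x => `|phi (x + a) - phi x|)); last exact: (bJ _).1.
have bp' := test_function_bcfun (test_function_partial i tp).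
exact: (Rintegral_translate_le bp bp' (test_function_taylor1 i tp)).
Qed.

Lemma superlevel_closed phi (lambda : R) : continuous phi ->
  closed [set x | lambda <= `|phi x|].
Proof.
move=> cphi; rewrite (_ : [set _ | _] = (fun x => `|phi x|) @^-1` [set s | lambda <= s]) //.
apply: preimage_closed; last exact: closed_ge.
by move=> x _; exact: cvg_norm (cphi x).
Qed.

Lemma superlevel_finite phi (lambda : R) : 0 < lambda -> bcfun phi ->
  (leb [set x | (lambda <= `|phi x|)%R] < +oo)%E.
Proof.
move=> l0 [cphi [M [r Mr]]].
apply: bounded_leb_lty; exists r; split; first exact: num_real.
move=> N rN x /= lp; apply: le_trans (ltW rN); apply: (Mr x).2.
by rewrite -normr_gt0; exact: lt_le_trans lp.
Qed.

(* If most translates x + h, h in [0, r]^n, of a point x of the level set leave the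
   half level set, then |phi (x + h) - phi x| is large there for a common h. *)
Lemma test_function_superlevel_le phi (lambda r : R) : test_function Omega phi ->
  0 < lambda -> 0 < r ->
  4 * fine (leb [set x | lambda / 2 <= `|phi x|]) <= r ^+ n ->
  lambda / 4 * fine (leb [set x | lambda <= `|phi x|]) <=
  r * \sum_(i < n) \int[leb]_x `|partial i phi x|.
Proof.
move=> tp l0 r0 Hr; have bp := test_function_bcfun tp.
set E := [set x | lambda <= _]; set E' := [set x | lambda / 2 <= _] in Hr.
have cE : closed E by exact: superlevel_closed bp.1.
have cE' : closed E' by exact: superlevel_closed bp.1.
have l20 : 0 < lambda / 2 by rewrite divr_gt0.
have fE : leb E = (fine (leb E))%:E.
  by rewrite fineK// ge0_fin_numE//; exact: superlevel_finite.
have fE' : leb E' = (fine (leb E'))%:E.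
  by rewrite fineK// ge0_fin_numE//; exact: superlevel_finite.
set e := fine (leb E) in fE *; set e' := fine (leb E') in fE' Hr.
have e0 : 0 <= e by exact: fine_ge0.
have e'0 : 0 <= e' by exact: fine_ge0.
have [h h01 Hh] := exists_rV_shift_small_overlap r0 cE cE' fE fE'.
have mE : measurable E by exact: (rV_measurable (measurable_pre_closed cE)).
have mE' : measurable E' by exact: (rV_measurable (measurable_pre_closed cE')).
set P := (fun x => x + h)%R @^-1` E' in Hh.
have mP : measurable P by rewrite -[P]setTI; exact: measurable_rV_shift.
have bJ : bcfun (fun x => `|phi (x + h) - phi x|).
  by apply: bcfun_norm; apply: bcfunB => //; exact: bcfun_shift.
have rn0 : 0 < r ^+ n by rewrite exprn_gt0.
(* Since 4 |E'| <= r^n, the overlap 2 e e' / r^n is at most e / 2. *)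
have eD : e / 2 <= fine (leb (E `\` P)).
  have EI : leb E = (leb (E `\` P) + leb (E `&` P))%E by exact: measureDI.
  have Df : leb (E `\` P) \is a fin_num.
    rewrite ge0_fin_numE//; apply: (@le_lt_trans _ _ (leb E)).
      by apply: le_measure; rewrite ?inE//; exact: measurableD.
    by rewrite fE ltry.
  have If : leb (E `&` P) \is a fin_num.
    by rewrite ge0_fin_numE//; apply: le_lt_trans Hh _; rewrite ltry.
  have : e <= fine (leb (E `\` P)) + 2 * e * e' / r ^+ n.
    rewrite -lee_fin -fE EI EFinD fineK//; exact: leeD2l.
  suff : 2 * e * e' / r ^+ n <= e / 2 by lra.
  by rewrite ler_pdivrMr//; nra.
(* On E minus P, |phi| is at least lambda before the shift and below lambda / 2 after it. *)
have : lambda / 2 * (e / 2) <= \int[leb]_x `|phi (x + h) - phi x|.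
  apply: (@le_trans _ _ (\int[leb]_(x in E `\` P) (lambda / 2))).
    by rewrite Rintegral_cst; [rewrite ler_wpM2l// ltW|exact: measurableD].
  have mD : measurable (E `\` P) by exact: measurableD.
  apply: (@le_trans _ _ (\int[leb]_(x in E `\` P) `|phi (x + h) - phi x|)).
    apply: le_Rintegral => //.
    - apply: integrable_cst_lty => //; apply: (@le_lt_trans _ _ (leb E)).
        by apply: le_measure; rewrite ?inE//; exact: measurableD.
      by rewrite fE ltry.
    - exact: bcfun_integrable.
    - move=> x [Ex /negP nPx]; rewrite /P /E' /= -ltNge in nPx.
      have Ex' : lambda <= `|phi x| := Ex.
      have := lerB_dist (phi x) (phi (x + h)); rewrite distrC; lra.
  rewrite Rintegral_mkcond; apply: le_Rintegral => //.
  - rewrite -restrict_EFin; apply/(integrable_mkcond _ mD).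
    exact: bcfun_integrable.
  - exact: (bcfun_integrable measurableT bJ).
  - by move=> x _; rewrite patchE; case: ifP => _; rewrite ?lexx ?normr_ge0.
move=> /le_trans /(_ (test_function_translate h tp)).
suff : \sum_(i < n) `|h 0 i| * \int[leb]_x `|partial i phi x| <=
   r * \sum_(i < n) \int[leb]_x `|partial i phi x| by lra.
rewrite mulr_sumr; apply: ler_sum => i _; apply: ler_wpM2r.
  by apply: Rintegral_ge0.
by have /andP[h0 hr] := h01 i; rewrite ger0_norm.
Qed.

End test_functions.

(** * Square integrable functions *)

(** This stands in for the limit delta -> 0: the approximation arguments end with an error linear in
    delta, known for small delta. *)
Lemma le_small_error (R : realType) (a b C delta0 : R) : 0 < delta0 ->
  (forall delta, 0 < delta <= delta0 -> a <= b + C * delta) -> a <= b.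
Proof.
move=> d0 H; apply/ler_addgt0Pr => e e0.
have C0 : 0 < `|C| + 1 by rewrite ltr_pwDr.
pose delta := Num.min delta0 (e / (`|C| + 1)).
have dd : 0 < delta by rewrite lt_min d0 divr_gt0.
apply: (le_trans (H delta _)); first by rewrite dd ge_min lexx.
rewrite lerD2l.
have : delta * (`|C| + 1) <= e by rewrite -ler_pdivlMr// ge_min lexx orbT.
have := ler_norm C; nra.
Qed.

(** The right side exceeds the left by delta (|a| - |b| / delta)^2 + |a b|. The parameter later
    serves either as an approximation error or as the t of the decay estimate. *)
Lemma young (R : realType) (delta a b : R) : 0 < delta ->
  `|a * b| <= delta * a ^+ 2 + delta^-1 * b ^+ 2.
Proof.
move=> d0; rewrite normrM -[a ^+ 2]real_normK ?num_real// -[b ^+ 2]real_normK ?num_real//.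
set x := `|a|; set y := `|b|.
have x0 : 0 <= x by exact: normr_ge0.
have y0 : 0 <= y by exact: normr_ge0.
have -> : delta * x ^+ 2 + delta^-1 * y ^+ 2 =
  delta * (x - delta^-1 * y) ^+ 2 + 2 * (x * y) by field; rewrite gt_eqF.
have : 0 <= delta * (x - delta^-1 * y) ^+ 2 by rewrite mulr_ge0 ?sqr_ge0// ltW.
have : 0 <= x * y by rewrite mulr_ge0.
lra.
Qed.

Section square_integrable.
Context d (T : measurableType d) (R : realType).
Variables (mu : {measure set T -> \bar R}) (D : set T).
Hypotheses (mD : measurable D) (Dfin : (mu D < +oo)%E).
Implicit Types f g : T -> R.

(** For [leb] on Omega this is convertible with [L2], and proofs of one are passed directly for the
    other. *)
Definition sqint f := measurable_fun D f /\
  mu.-integrable D (EFin \o (fun x => f x ^+ 2)).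

Lemma le_integrableR f g : measurable_fun D f -> (forall x, D x -> `|f x| <= g x) ->
  mu.-integrable D (EFin \o g) -> mu.-integrable D (EFin \o f).
Proof.
move=> mf fg ig; apply: le_integrable ig => //; first exact/measurable_EFinP.
by move=> x Dx /=; rewrite lee_fin; apply: le_trans (fg x Dx) _; exact: ler_norm.
Qed.

Lemma integrableDR f g : mu.-integrable D (EFin \o f) -> mu.-integrable D (EFin \o g) ->
  mu.-integrable D (EFin \o (fun x => f x + g x)).
Proof. by move=> i1 i2; exact: (integrableD mD i1 i2). Qed.

Lemma integrableBR f g : mu.-integrable D (EFin \o f) -> mu.-integrable D (EFin \o g) ->
  mu.-integrable D (EFin \o (fun x => f x - g x)).
Proof. by move=> i1 i2; exact: (integrableB mD i1 i2). Qed.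

Lemma integrableZR (k : R) f : mu.-integrable D (EFin \o f) ->
  mu.-integrable D (EFin \o (fun x => k * f x)).
Proof. by move=> i1; exact: (integrableZl mD k i1). Qed.

Lemma integrable_measurableR f : mu.-integrable D (EFin \o f) -> measurable_fun D f.
Proof. by move=> /integrableP[/measurable_EFinP]. Qed.

Lemma integrable_normR f : mu.-integrable D (EFin \o f) ->
  mu.-integrable D (EFin \o (fun x => `|f x|)).
Proof. exact: integrable_norm. Qed.

Lemma sqintM f g : sqint f -> sqint g -> mu.-integrable D (EFin \o (fun x => f x * g x)).
Proof.
move=> [mf f2] [mg g2].
apply: (le_integrableR (g := fun x => 1 * f x ^+ 2 + 1^-1 * g x ^+ 2)).
- exact: measurable_funM.
- by move=> x _; exact: young.
- by apply: integrableDR; apply: integrableZR.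
Qed.

Lemma sqint_bounded f (K : R) : measurable_fun D f ->
  (forall x, D x -> `|f x| <= K) -> sqint f.
Proof.
move=> mf fK; split => //; apply: measurable_bounded_integrable => //.
  exact: measurable_funX.
exists (K ^+ 2); split; first exact: num_real.
move=> M KM x Dx; apply: le_trans (ltW KM); rewrite normrX.
by rewrite lerXn2r ?nnegrE ?fK// (le_trans _ (fK x Dx)).
Qed.

Lemma sqint_integrable f : sqint f -> mu.-integrable D (EFin \o f).
Proof.
move=> sf; have s1 : sqint (cst 1) by apply: (sqint_bounded (K := 1)) => // x _;
  rewrite normr1.
have := sqintM s1 sf; congr (_.-integrable D (_ \o _)).
by apply/funext => x /=; rewrite mul1r.
Qed.

Lemma sqintB f g : sqint f -> sqint g -> sqint (fun x => f x - g x).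
Proof.
move=> sf sg; have [mf f2] := sf; have [mg g2] := sg; split; first exact: measurable_funB.
rewrite (_ : (fun x => _) = (fun x => f x ^+ 2 + (g x ^+ 2 - 2 * (f x * g x)))); last first.
  by apply/funext => x; ring.
by apply: integrableDR => //; apply: integrableBR => //; apply: integrableZR; exact: sqintM.
Qed.

Lemma Rintegral_young f g (delta : R) : 0 < delta -> sqint f -> sqint g ->
  \int[mu]_(x in D) `|f x * g x| <=
  delta * (\int[mu]_(x in D) f x ^+ 2) + delta^-1 * (\int[mu]_(x in D) g x ^+ 2).
Proof.
move=> d0 sf sg; have [_ f2] := sf; have [_ g2] := sg.
rewrite -!RintegralZl// -RintegralD//; try exact: integrableZR.
apply: le_Rintegral => //.
- by apply: integrable_normR; exact: sqintM.
- by apply: integrableDR; exact: integrableZR.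
- by move=> x _; exact: young.
Qed.

Lemma le_Rintegral_setS f (A : set T) : measurable A -> A `<=` D ->
  mu.-integrable D (EFin \o f) -> (forall x, D x -> 0 <= f x) ->
  \int[mu]_(x in A) f x <= \int[mu]_(x in D) f x.
Proof.
move=> mA AD fi f0; have iA := integrableS mD mA AD fi.
apply: fine_le; try exact: integrable_fin_num.
apply: ge0_subset_integral => //.
  by apply/measurable_EFinP; exact: integrable_measurableR.
Qed.

Lemma chebyshev_sqr f (c : R) : 0 < c -> sqint f ->
  c ^+ 2 * fine (mu (D `&` [set x | c <= `|f x|])) <= \int[mu]_(x in D) f x ^+ 2.
Proof.
move=> c0 [mf f2].
have mA : measurable (D `&` [set x | c <= `|f x|]).
  rewrite (_ : [set _ | _] = (fun x => `|f x|) @^-1` `[c, +oo[%classic); last first.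
    by apply/seteqP; split => x /=; rewrite in_itv /= andbT.
  by apply: measurableT_comp => //.
rewrite -Rintegral_cst//.
apply: (@le_trans _ _ (\int[mu]_(x in D `&` [set x | c <= `|f x|]) f x ^+ 2)).
  apply: le_Rintegral => //.
  - apply: integrable_cst_lty => //; apply: le_lt_trans Dfin.
    by apply: le_measure; rewrite ?inE.
  - by apply: integrableS f2.
  - move=> x [_ /= cf]; rewrite -[leRHS]real_normK ?num_real//.
    by rewrite lerXn2r ?nnegrE// ltW.
by apply: le_Rintegral_setS => // x _; exact: sqr_ge0.
Qed.

End square_integrable.

(** * Approximation in W_0^{1,2} *)

Section W0_approximation.
Context {R : realType} (n : nat) (Omega : set 'rV[R]_n).
Hypotheses (Omega_open : open Omega) (Omega_bounded : bounded_set Omega).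
Implicit Types (v : 'rV[R]_n -> R) (G : 'rV[R]_n -> 'rV[R]_n).
Local Notation sqi := (sqint leb Omega).

Let mO : measurable Omega := rV_open_measurable Omega_open.
Let Ofin : (leb Omega < +oo)%E := bounded_leb_lty Omega_bounded.

Lemma test_functionB phi psi : test_function Omega phi -> test_function Omega psi ->
  test_function Omega (fun x => phi x - psi x).
Proof.
move=> [s1 c1 o1] [s2 c2 o2].
have E s : iter_partial s (fun x => phi x - psi x) =
    (fun x => iter_partial s phi x - iter_partial s psi x).
  elim: s => [//|i s IH] /=; rewrite IH; apply/funext => x.
  apply: (@deriveB _ _ _ (iter_partial s phi) (iter_partial s psi)).
    by have [_] := s1 s; apply.
  by have [_] := s2 s; apply.
have S : closed_support (fun x => phi x - psi x)
  `<=` closed_support phi `|` closed_support psi.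
  rewrite [X in _ `<=` X](closure_id _).1; last first.
    by apply: closedU; exact: closed_closure.
  apply: closureS => x /= fx.
  have [p0|p0] := eqVneq (phi x) 0; last by left; exact: subset_closure.
  right; apply: subset_closure => /=; apply: contra_neq fx => ->; by rewrite p0 subrr.
split.
- move=> s; rewrite E; have [a1 b1] := s1 s; have [a2 b2] := s2 s; split.
    by move=> x; exact: cvgB (a1 x) (a2 x).
  by move=> i x; exact: derivableB (b1 i x) (b2 i x).
- by apply: subclosed_compact (compactU c1 c2) S; exact: closed_closure.
- by apply: subset_trans S _ => x [/o1|/o2].
Qed.

Lemma partialB i phi psi : test_function Omega phi -> test_function Omega psi ->
  partial i (fun x => phi x - psi x) = (fun x => partial i phi x - partial i psi x).
Proof.
move=> [s1 _ _] [s2 _ _]; apply/funext => x.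
apply: (@deriveB _ _ _ phi psi).
  by have [_] := s1 [::]; apply.
by have [_] := s2 [::]; apply.
Qed.

(* v is in W_0^{1,2} with gradient G; by approximation, the weak gradient property
   is a consequence. *)
Definition W0_approx v G := [/\ sqi v, forall i, sqi (fun x => G x 0 i) &
  forall e : R, 0 < e -> exists2 phi, test_function Omega phi &
    \int[leb]_(x in Omega) (v x - phi x) ^+ 2 <= e /\
    forall i, \int[leb]_(x in Omega) (G x 0 i - partial i phi x) ^+ 2 <= e].

Lemma bcfun_sqint f : bcfun f -> sqi f.
Proof.
move=> [cf [M [r Mr]]]; apply: (sqint_bounded mO Ofin (K := M)).
  exact: rV_continuous_measurable.
by move=> x _; exact: (Mr x).1.
Qed.

Lemma test_function_sqint phi : test_function Omega phi -> sqi phi.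
Proof. by move=> /test_function_bcfun; exact: bcfun_sqint. Qed.

(** The same G must serve both conclusions: [W12] is what the entropy inequality and
    [generalized_gradient] ask for, [W0_approx] is what the estimates use. *)
Lemma W012_approx v : W012 Omega v -> exists2 G, W12 Omega v G & W0_approx v G.
Proof.
move=> [G WG [phi tphi phi0]]; exists G; first exact: WG.
have [L2v L2G _] := WG; split => // e e0.
have /fine_cvgP[finF] := phi0.
move=> /cvgrPdist_lt /(_ e e0) H.
have [k [fk Hk]] : exists k, (\int[leb]_(x in Omega) ((v x - phi k x) ^+ 2 +
    \sum_(i < n) (G x 0 i - partial i (phi k) x) ^+ 2)%:E)%E \is a fin_num /\
   \int[leb]_(x in Omega) ((v x - phi k x) ^+ 2 +
    \sum_(i < n) (G x 0 i - partial i (phi k) x) ^+ 2) < e.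
  near \oo => k; exists k; split; first by near: k.
  have : `|0 - fine (\int[leb]_(x in Omega) ((v x - phi k x) ^+ 2 +
    \sum_(i < n) (G x 0 i - partial i (phi k) x) ^+ 2)%:E)%E| < e by near: k.
  by rewrite sub0r normrN; apply: le_lt_trans; exact: ler_norm.
have tk := tphi k.
have s1 : sqi (fun x => v x - phi k x).
  exact: (sqintB mO L2v (test_function_sqint tk)).
have s2 i : sqi (fun x => G x 0 i - partial i (phi k) x).
  exact: (sqintB mO (L2G i) (test_function_sqint (test_function_partial i tk))).
have S0 x : 0 <= \sum_(i < n) (G x 0 i - partial i (phi k) x) ^+ 2.
  by apply: sumr_ge0 => i _; exact: sqr_ge0.
have iS : leb.-integrable Omega (EFin \o (fun x => (v x - phi k x) ^+ 2 +
    \sum_(i < n) (G x 0 i - partial i (phi k) x) ^+ 2)).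
  apply: integrableDR => //; first exact: s1.2.
  rewrite (_ : EFin \o _ =
    (fun x => \sum_(i < n) (EFin \o (fun x => (G x 0 i - partial i (phi k) x) ^+ 2)%R)
      x)%E).
    by apply: integrable_sum => // i _; exact: (s2 i).2.
  by apply/funext => x /=; rewrite sumEFin.
exists (phi k) => //; split => [|i]; apply: le_trans (ltW Hk).
- apply: le_Rintegral => //; first exact: s1.2.
  by move=> x _; rewrite lerDl.
- apply: le_Rintegral => //; first exact: (s2 i).2.
  move=> x _; apply: (@le_trans _ _ (\sum_(i < n) (G x 0 i - partial i (phi k) x) ^+ 2)).
    rewrite (bigD1 i) //= lerDl; apply: sumr_ge0 => j _; exact: sqr_ge0.
  by rewrite lerDr sqr_ge0.
Unshelve. all: by end_near. Qed.

Lemma W0_approxB v w G H : W0_approx v G -> W0_approx w H ->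
  W0_approx (fun x => v x - w x) (fun x => G x - H x).
Proof.
move=> [sv sG Hv] [sw sH Hw]; split.
- exact: sqintB.
- move=> i; rewrite (_ : (fun _ => _) = (fun x => G x 0 i - H x 0 i)); first exact: sqintB.
  by apply/funext => x; rewrite !mxE.
(* Since (p - q)^2 <= 2 p^2 + 2 q^2, errors e / 4 suffice. *)
move=> e e0; have e40 : 0 < e / 4 by rewrite divr_gt0.
have key (a b p q : 'rV[R]_n -> R) : sqi a -> sqi b -> sqi p -> sqi q ->
    \int[leb]_(x in Omega) (a x - p x) ^+ 2 <= e / 4 ->
    \int[leb]_(x in Omega) (b x - q x) ^+ 2 <= e / 4 ->
    \int[leb]_(x in Omega) (a x - b x - (p x - q x)) ^+ 2 <= e.
  move=> sa sb sp sq H1 H2.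
  have sap := sqintB mO sa sp; have sbq := sqintB mO sb sq.
  apply: (@le_trans _ _ (2 * (\int[leb]_(x in Omega) (a x - p x) ^+ 2) +
      2 * (\int[leb]_(x in Omega) (b x - q x) ^+ 2))); last lra.
  have iap := sap.2; have ibq := sbq.2.
  rewrite -!RintegralZl// -RintegralD//; try exact: integrableZR.
  apply: le_Rintegral => //.
  - exact: (sqintB mO (sqintB mO sa sb) (sqintB mO sp sq)).2.
  - by apply: integrableDR => //; exact: integrableZR.
  - move=> x _.
    have -> : 2 * (a x - p x) ^+ 2 + 2 * (b x - q x) ^+ 2 =
      (a x - b x - (p x - q x)) ^+ 2 + (a x - p x + (b x - q x)) ^+ 2 by ring.
    by rewrite lerDl sqr_ge0.
have [phi tphi [p1 p2]] := Hv _ e40; have [psi tpsi [q1 q2]] := Hw _ e40.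
have tp i := test_function_partial i tphi; have tq i := test_function_partial i tpsi.
exists (fun x => phi x - psi x); first exact: test_functionB.
have sp := test_function_sqint tphi; have sq := test_function_sqint tpsi.
split; first exact: (key v w phi psi).
move=> i; rewrite partialB//; under eq_Rintegral do rewrite !mxE.
exact: (key _ _ _ _ (sG i) (sH i) (test_function_sqint (tp i))
  (test_function_sqint (tq i))).
Qed.

End W0_approximation.

(** * The superlevel estimate in W_0^{1,2} *)

Section W0_superlevel.
Context {R : realType} (n : nat) (Omega : set 'rV[R]_n).
Hypotheses (Omega_open : open Omega) (Omega_bounded : bounded_set Omega).
Implicit Types (v : 'rV[R]_n -> R) (G : 'rV[R]_n -> 'rV[R]_n).
Local Notation sqi := (sqint leb Omega).

Let mO : measurable Omega := rV_open_measurable Omega_open.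
Let Ofin : (leb Omega < +oo)%E := bounded_leb_lty Omega_bounded.

Lemma Rintegral_supported (f : 'rV[R]_n -> R) : (forall x, f x != 0 -> Omega x) ->
  \int[leb]_x f x = \int[leb]_(x in Omega) f x.
Proof.
move=> fO; rewrite [RHS]Rintegral_mkcond; apply: eq_Rintegral => x _.
rewrite patchE; case: ifPn => //; rewrite notin_setE => nx.
by apply/eqP/negP => /negP /fO.
Qed.

Lemma measurable_superlevel v (c : R) : measurable_fun Omega v ->
  measurable (Omega `&` [set x | c <= `|v x|]).
Proof.
move=> mv; rewrite (_ : [set _ | _] = (fun x => `|v x|) @^-1` `[c, +oo[%classic);
  last first.
  by apply/seteqP; split => x /=; rewrite in_itv /= andbT.
have mnv : measurable_fun Omega (fun x => `|v x|) by exact: measurableT_comp.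
exact: mnv.
Qed.
Arguments measurable_superlevel [v] c _.

Lemma fine_leb_le_setU (A B C : set 'rV[R]_n)
  : measurable A -> measurable B -> measurable C ->
  B `<=` Omega -> C `<=` Omega -> A `<=` B `|` C ->
  fine (leb A) <= fine (leb B) + fine (leb C).
Proof.
move=> mA mB mC BO CO ABC.
have fin S : measurable S -> S `<=` Omega -> leb S \is a fin_num.
  move=> mS SO; rewrite ge0_fin_numE//; apply: le_lt_trans Ofin.
  by apply: le_measure; rewrite ?inE.
have fB := fin _ mB BO; have fC := fin _ mC CO.
have fA : leb A \is a fin_num by apply: fin => // x /ABC[/BO|/CO].
rewrite -lee_fin EFinD !fineK//.
apply: (@le_trans _ _ (leb (B `|` C))).
  by apply: le_measure; rewrite ?inE//; exact: measurableU.
exact: measureU2.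
Qed.

(** The strict inequality leaves a slack b that pays, through Chebyshev, for replacing v by a test
    function phi. The test function estimate is used at level lambda / 2, and its half level lambda
    / 4 is compared with the level lambda / 8 of v. *)
Lemma W0_approx_superlevel_le v G (lambda r : R) : W0_approx Omega v G ->
  0 < lambda -> 0 < r ->
  4 * fine (leb (Omega `&` [set x | lambda / 8 <= `|v x|])) < r ^+ n ->
  lambda / 8 * fine (leb (Omega `&` [set x | lambda <= `|v x|])) <=
  r * \sum_(i < n) \int[leb]_(x in Omega) `|G x 0 i|.
Proof.
move=> [sv sG Hv] l0 r0.
set E := Omega `&` [set x | lambda <= _].
set E' := Omega `&` [set x | lambda / 8 <= _] => E'r.
have mE : measurable E by exact: measurable_superlevel sv.1.
have mE' : measurable E' by exact: measurable_superlevel sv.1.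
pose b := r ^+ n - 4 * fine (leb E').
have b0 : 0 < b by rewrite /b; lra.
pose V := fine (leb Omega).
have l20 : 0 < lambda ^+ 2 by rewrite exprn_gt0.
(* The term with V + 1 is the L^1 error on the gradient, 1 / (2 lambda) the Chebyshev error at level
   lambda / 2. The threshold on d makes four times the Chebyshev bound 64 d / lambda^2 at most b. *)
apply: (@le_small_error _ _ _ (r * (n%:R * (V + 1)) + 2^-1 / lambda)
   (Num.min 1 (lambda ^+ 2 * b / 256))).
  by rewrite lt_min ltr01 divr_gt0// mulr_gt0.
move=> d /andP[d0]; rewrite le_min => /andP[d1 db].
have d20 : 0 < d ^+ 2 by rewrite exprn_gt0.
have dd : d ^+ 2 <= d by rewrite expr2 ler_piMr// ltW.
(* The squared L^2 errors are d^2, so Young's inequality with parameter d turns them into L^1 errors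
   (V + 1) d. *)
have [phi tphi [phi1 phi2]] := Hv _ d20.
have bphi := test_function_bcfun tphi.
have sphi := test_function_sqint Omega_open Omega_bounded tphi.
have svp : sqi (fun x => v x - phi x) by exact: sqintB.
pose S c := [set x | c <= `|phi x|].
have mS c : measurable (S c).
  have cS : closed (S c) by exact: superlevel_closed bphi.1.
  exact: (rV_measurable (measurable_pre_closed cS)).
have SO c x : 0 < c -> S c x -> Omega x.
  move=> c0 Sx; apply: (test_function_support tphi); rewrite -normr_gt0.
  exact: lt_le_trans Sx.
pose P c := Omega `&` [set x | c <= `|v x - phi x|].
have mP c : measurable (P c).
  exact: (measurable_superlevel (v := fun x => v x - phi x) c svp.1).
have cheb c : 0 < c -> c ^+ 2 * fine (leb (P c)) <= d.
  move=> c0; apply: le_trans dd; apply: le_trans phi1.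
  exact: (chebyshev_sqr mO Ofin c0 svp).
have H1 : 4 * fine (leb (S (lambda / 2 / 2))) <= r ^+ n.
  have H : fine (leb (S (lambda / 2 / 2))) <= fine (leb E') + fine (leb (P (lambda / 8))).
    apply: fine_leb_le_setU => //; try exact: subIsetl.
    move=> x Sx; have Ox : Omega x by apply: SO Sx; lra.
    have [?|vl] := leP (lambda / 8) `|v x|; [by left|right; split => //=].
    have Sx' : lambda / 2 / 2 <= `|phi x| := Sx.
    have := lerB_dist (phi x) (v x); rewrite distrC; lra.
  have c8 : 0 < lambda / 8 by lra.
  have := cheb _ c8; rewrite exprMn => Hc.
  have : lambda ^+ 2 * (4 * fine (leb (P (lambda / 8)))) <= lambda ^+ 2 * b by lra.
  rewrite ler_pM2l// /b; lra.
have l2 : 0 < lambda / 2 by lra.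
have H2 := test_function_superlevel_le tphi l2 r0 H1.
have H3 : fine (leb E) <= fine (leb (S (lambda / 2))) + fine (leb (P (lambda / 2))).
  apply: fine_leb_le_setU => //; try exact: subIsetl.
    by move=> x; exact: SO.
  move=> x [Ox Ex]; have Ex' : lambda <= `|v x| := Ex.
  have [?|vl] := leP (lambda / 2) `|phi x|; [by left|right; split => //=].
  have := lerB_dist (v x) (phi x); lra.
have H4 : lambda / 8 * fine (leb (P (lambda / 2))) <= 2^-1 / lambda * d.
  have := cheb _ l2; rewrite exprMn => Hc.
  rewrite -(ler_pM2l l0) [leRHS](_ : _ = d / 2); last by field; rewrite gt_eqF.
  rewrite [leLHS](_ : _ = lambda ^+ 2 * 2^-1 ^+ 2 * fine (leb (P (lambda / 2))) / 2);
    last by field.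
  by rewrite ler_wpM2r ?invr_ge0.
have H5 i : \int[leb]_x `|partial i phi x| <= \int[leb]_(x in Omega)
  `|G x 0 i| + (V + 1) * d.
  have tp := test_function_partial i tphi.
  have sp := test_function_sqint Omega_open Omega_bounded tp.
  have sGp : sqi (fun x => G x 0 i - partial i phi x) by exact: (sqintB mO (sG i) sp).
  have iG := integrable_normR (sqint_integrable mO Ofin (sG i)).
  have iGp := integrable_normR (sqint_integrable mO Ofin sGp).
  rewrite Rintegral_supported; last first.
    by move=> x; rewrite normr_eq0; exact: test_function_support tp.
  have s1 : sqi (cst 1) by apply: (sqint_bounded mO Ofin (K := 1)) => // x _;
    rewrite normr1.
  have Y1 : \int[leb]_(x in Omega) `|cst 1 x * (G x 0 i - partial i phi x)| =
      \int[leb]_(x in Omega) `|G x 0 i - partial i phi x|.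
    by apply: eq_Rintegral => x _; rewrite mul1r.
  have Y2 : \int[leb]_(x in Omega) (cst 1 x : R) ^+ 2 = V.
    by under eq_Rintegral do rewrite expr1n; rewrite Rintegral_cst// mul1r.
  have := Rintegral_young mO d0 s1 sGp; rewrite Y1 Y2.
  have : d^-1 * (\int[leb]_(x in Omega) (G x 0 i - partial i phi x) ^+ 2) <= d.
    by rewrite ler_pdivrMl// -expr2.
  suff : \int[leb]_(x in Omega) `|partial i phi x| <= \int[leb]_(x in Omega) `|G x 0 i| +
    \int[leb]_(x in Omega) `|G x 0 i - partial i phi x| by lra.
  rewrite -RintegralD//; apply: le_Rintegral => //.
  - exact: (integrable_normR (sqint_integrable mO Ofin sp)).
  - exact: integrableDR.
  - move=> x _; have := lerB_dist (partial i phi x) (G x 0 i); rewrite distrC; lra.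
have H6 : \sum_(i < n) \int[leb]_x `|partial i phi x| <=
    \sum_(i < n) \int[leb]_(x in Omega) `|G x 0 i| + n%:R * ((V + 1) * d).
  apply: le_trans (ler_sum _ (fun i _ => H5 i)) _.
  by rewrite big_split /= sumr_const card_ord mulr_natl.
have l80 : 0 < lambda / 8 by lra.
have H7 : lambda / 8 * fine (leb E) <= lambda / 2 / 4 * fine (leb (S (lambda / 2))) +
   lambda / 8 * fine (leb (P (lambda / 2))).
  rewrite (_ : lambda / 2 / 4 = lambda / 8); last by lra.
  by rewrite -mulrDr ler_pM2l.
have H8 : r * \sum_(i < n) \int[leb]_x `|partial i phi x| <=
    r * (\sum_(i < n) \int[leb]_(x in Omega) `|G x 0 i| + n%:R * ((V + 1) * d)).
  by rewrite ler_pM2l.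
lra.
Qed.

End W0_superlevel.

(** * Gradients vanish on level sets *)

Section cutoff.
Context {R : realType}.

(** The bounds are in the form that [taylor1_comp] takes; the Lipschitz bound on psi' serves to pass
    from test functions to W_0^{1,2}. *)
Definition lipschitz_C1 (C : R) (psi psi' : R -> R) := [/\ 0 <= C,
  forall s, `|psi s| <= C /\ `|psi' s| <= C,
  forall s s', `|psi s' - psi s| <= C * `|s' - s|,
  forall s s', `|psi' s' - psi' s| <= C * `|s' - s| &
  forall s s', `|psi s' - psi s - (s' - s) * psi' s| <= C * (s' - s) ^+ 2].

Lemma lipschitz_continuousR (C : R) (f : R -> R) :
  (forall s s', `|f s' - f s| <= C * `|s' - s|) -> continuous f.
Proof.
move=> Hf s; apply/cvgrPdist_lt => e e0.
have C0 : 0 < `|C| + 1 by rewrite ltr_pwDr.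
near=> t.
have st : `|s - t| < e / (`|C| + 1).
  by near: t; apply: cvgr_dist_lt; [exact: cvg_id|exact: divr_gt0].
apply: le_lt_trans (Hf _ _) _.
apply: (@le_lt_trans _ _ ((`|C| + 1) * `|s - t|)).
  by apply: ler_wpM2r => //; apply: le_trans (ler_norm _) _; rewrite lerDl.
by rewrite mulrC -ltr_pdivlMr.
Unshelve. all: by end_near. Qed.

(** A bounded function whose derivative is 1 at 0 and tends to 0 at infinity; as it is rational, its
    Taylor and Lipschitz bounds are polynomial inequalities. *)
Definition bump (z : R) := z / (1 + z ^+ 2).
Definition bump' (z : R) := (1 - z ^+ 2) / (1 + z ^+ 2) ^+ 2.

Lemma one_sqr_gt0 (z : R) : 0 < 1 + z ^+ 2.
Proof. by have := sqr_ge0 z; lra. Qed.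
Local Hint Resolve one_sqr_gt0 : core.

Lemma norm_le_one_sqr (z : R) : `|z| <= 1 + z ^+ 2.
Proof.
have : 0 <= (`|z| - 1) ^+ 2 by exact: sqr_ge0.
rewrite sqrrB1 real_normK ?num_real//; have := normr_ge0 z; nra.
Qed.

Lemma norm_one_sub_sqr (z : R) : `|1 - z ^+ 2| <= 1 + z ^+ 2.
Proof. by have := sqr_ge0 z; rewrite ler_norml; lra. Qed.

Lemma bump_le1 z : `|bump z| <= 1.
Proof.
by rewrite normrM normfV (gtr0_norm (one_sqr_gt0 z)) ler_pdivrMr// mul1r norm_le_one_sqr.
Qed.

Lemma bump'_le z : `|bump' z| <= (1 + z ^+ 2)^-1.
Proof.
rewrite normrM normfV normrX (gtr0_norm (one_sqr_gt0 z)) ler_pdivrMr ?exprn_gt0//.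
rewrite [leRHS](_ : _ = 1 + z ^+ 2); last by field; rewrite gt_eqF.
exact: norm_one_sub_sqr.
Qed.

Lemma bump'_le1 z : `|bump' z| <= 1.
Proof.
apply: le_trans (bump'_le z) _; rewrite invf_le1//.
by have := sqr_ge0 z; lra.
Qed.

Lemma bump_taylor z w : `|bump w - bump z - (w - z) * bump' z| <= 2 * (w - z) ^+ 2.
Proof.
have z0 := one_sqr_gt0 z; have w0 := one_sqr_gt0 w.
(* The remainder is divisible by (w - z)^2; what is left is a rational factor to be bounded by 2. *)
have -> : bump w - bump z - (w - z) * bump' z =
    (w - z) ^+ 2 * ((- 2 * z - (1 - z ^+ 2) * w) / ((1 + z ^+ 2) ^+ 2 * (1 + w ^+ 2))).
  by rewrite /bump /bump'; field; rewrite !gt_eqF.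
rewrite normrM (ger0_norm (sqr_ge0 _)) mulrC ler_wpM2r ?sqr_ge0//.
have B0 : 0 < (1 + z ^+ 2) ^+ 2 * (1 + w ^+ 2) by rewrite mulr_gt0 ?exprn_gt0.
rewrite normrM normfV (gtr0_norm B0) ler_pdivrMr//.
apply: le_trans (ler_normB _ _) _; rewrite !normrM normrN (ger0_norm (_ : 0 <= 2))//.
set p := 1 + z ^+ 2 in z0 *; set q := 1 + w ^+ 2 in w0 *.
have p1 : 1 <= p by rewrite /p lerDl sqr_ge0.
have q1 : 1 <= q by rewrite /q lerDl sqr_ge0.
have h1 : 2 * `|z| <= p.
  have : 0 <= (`|z| - 1) ^+ 2 by exact: sqr_ge0.
  by rewrite sqrrB1 real_normK ?num_real// /p; lra.
have h2 : `|1 - z ^+ 2| * `|w| <= p * q.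
  by apply: ler_pM => //; [exact: norm_one_sub_sqr|exact: norm_le_one_sqr].
have : p <= p * q by rewrite ler_peMr// ltW.
have : p * q <= p ^+ 2 * q by rewrite ler_pM2r// expr2 ler_peMr// ltW.
lra.
Qed.

Lemma bump_lipschitz z w : `|bump w - bump z| <= `|w - z|.
Proof.
have -> : bump w - bump z = (w - z) * ((1 - z * w) / ((1 + z ^+ 2) * (1 + w ^+ 2))).
  by rewrite /bump; field; rewrite !gt_eqF.
have B0 : 0 < (1 + z ^+ 2) * (1 + w ^+ 2) by rewrite mulr_gt0.
rewrite normrM ler_piMr// normrM normfV (gtr0_norm B0) ler_pdivrMr// mul1r.
have := sqr_ge0 z; have := sqr_ge0 w; have := sqr_ge0 (z * w); have := sqr_ge0 (z + w);
  have := sqr_ge0 (z - w).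
by rewrite ler_norml => *; apply/andP; split; lra.
Qed.

(** Adding the Taylor remainders based at z and at w leaves (w - z)(bump' w - bump' z), bounded by 4
    (w - z)^2. *)
Lemma bump'_lipschitz z w : `|bump' w - bump' z| <= 4 * `|w - z|.
Proof.
have [->|wz] := eqVneq w z; first by rewrite !subrr normr0 mulr0.
have wz0 : 0 < `|w - z| by rewrite normr_gt0 subr_eq0.
rewrite -(ler_pM2l wz0) -normrM.
have H1 := bump_taylor z w; have H2 := bump_taylor w z.
rewrite mulrCA -expr2 real_normK ?num_real//.
have E : (w - z) * (bump' w - bump' z) = (bump w - bump z - (w - z) * bump' z) +
   (bump z - bump w - (z - w) * bump' w) by ring.
rewrite E; apply: le_trans (ler_normD _ _) _.
move: H2; rewrite -(sqrrN (z - w)) opprB; lra.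
Qed.

(* scaled_bump c N is O(1 / N), while scaled_bump' c N tends to the indicator of c. *)
Definition scaled_bump (c N s : R) := bump ((s - c) * N) / N.
Definition scaled_bump' (c N s : R) := bump' ((s - c) * N).

(** The constant may grow with N, because the chain rule is applied at each fixed N. *)
Lemma scaled_bump_nice c N : 1 <= N ->
  lipschitz_C1 (4 * N) (scaled_bump c N) (scaled_bump' c N).
Proof.
move=> N1; have N0 : 0 < N by lra.
have E s s' : (s' - c) * N - (s - c) * N = (s' - s) * N by ring.
have N4 : N <= 4 * N by lra.
split.
- by lra.
- move=> s; split.
    rewrite normrM normfV (gtr0_norm N0) ler_pdivrMr//.
    apply: le_trans (bump_le1 _) _; nra.
  by apply: le_trans (bump'_le1 _) _; lra.
- move=> s s'; rewrite /scaled_bump -mulrBl normrM normfV (gtr0_norm N0) ler_pdivrMr//.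
  apply: le_trans (bump_lipschitz _ _) _; rewrite E normrM (gtr0_norm N0).
  rewrite ler_wpM2r ?(ltW N0)// ler_peMl//; lra.
- move=> s s'; apply: le_trans (bump'_lipschitz _ _) _.
  by rewrite E normrM (gtr0_norm N0) mulrCA mulrC mulrAC.
- move=> s s'.
  have -> : scaled_bump c N s' - scaled_bump c N s - (s' - s) * scaled_bump' c N s =
    (bump ((s' - c) * N) - bump ((s - c) * N) -
     ((s' - c) * N - (s - c) * N) * bump' ((s - c) * N)) / N.
    by rewrite /scaled_bump /scaled_bump'; field; rewrite gt_eqF.
  rewrite normrM normfV (gtr0_norm N0) ler_pdivrMr//.
  apply: le_trans (bump_taylor _ _) _; rewrite E exprMn.
  have : 0 <= (s' - s) ^+ 2 by exact: sqr_ge0.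
  have : 0 < N ^+ 2 by rewrite exprn_gt0.
  nra.
Qed.

Lemma scaled_bump_le c N s : 1 <= N -> `|scaled_bump c N s| <= N^-1.
Proof.
move=> N1; have N0 : 0 < N by lra.
by rewrite normrM normfV (gtr0_norm N0) ler_piMl ?invr_ge0 ?(ltW N0)//; exact: bump_le1.
Qed.

Lemma scaled_bump'_cvg c s :
  (scaled_bump' c k.+1%:R s) @[k --> \oo] --> ((s == c)%:R : R).
Proof.
have [->|sc] := eqVneq s c.
  rewrite /scaled_bump' /bump' subrr.
  under eq_fun do rewrite mul0r expr0n /= subr0 addr0 expr1n divr1.
  exact: cvg_cst.
apply/cvgrPdist_lt => e e0; near=> k.
rewrite sub0r normrN /scaled_bump'; apply: le_lt_trans (bump'_le _) _.
have d0 : 0 < `|s - c| by rewrite normr_gt0 subr_eq0.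
have k0 : (0 : R) < k.+1%:R by rewrite ltr0n.
have ke : (`|s - c| * e)^-1 < k.+1%:R.
  near: k; exists (Num.truncn (`|s - c| * e)^-1) => // k /= kk.
  by apply: lt_le_trans (truncnS_gt _) _; rewrite ler_nat ltnS.
apply: (@le_lt_trans _ _ (`|s - c| * k.+1%:R)^-1).
  rewrite lef_pV2 ?posrE ?mulr_gt0//.
  have -> : `|s - c| * k.+1%:R = `|(s - c) * k.+1%:R| by rewrite normrM (gtr0_norm k0).
  exact: norm_le_one_sqr.
rewrite invfM -ltr_pdivlMl ?invr_gt0// invrK.
rewrite -[ltRHS]invrK ltf_pV2 ?posrE ?invr_gt0 ?mulr_gt0//.
Unshelve. all: by end_near. Qed.

End cutoff.

Section level_sets.
Context {R : realType} (n : nat) (Omega : set 'rV[R]_n).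
Hypotheses (Omega_open : open Omega) (Omega_bounded : bounded_set Omega).
Implicit Types (v : 'rV[R]_n -> R) (G : 'rV[R]_n -> 'rV[R]_n).
Local Notation sqi := (sqint leb Omega).

Let mO : measurable Omega := rV_open_measurable Omega_open.
Let Ofin : (leb Omega < +oo)%E := bounded_leb_lty Omega_bounded.

(** The integrand is the derivative of psi(phi) chi. As psi is only C^{1,1}, this product need not
    be a test function, hence the detour through [bcfun] and [taylor1]. *)
Lemma test_function_chain (i : 'I_n) phi chi (C : R) (psi psi' : R -> R) :
  lipschitz_C1 C psi psi' -> test_function Omega phi -> test_function Omega chi ->
  \int[leb]_(x in Omega) (psi (phi x) * partial i chi x +
     psi' (phi x) * partial i phi x * chi x) = 0.
Proof.
move=> [C0 p1 p2 p3 p4] tphi tchi.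
have bphi := test_function_bcfun tphi; have bchi := test_function_bcfun tchi.
have tphi' := test_function_partial i tphi; have tchi' := test_function_partial i tchi.
have bphi' := test_function_bcfun tphi'; have bchi' := test_function_bcfun tchi'.
have cpsi := lipschitz_continuousR p2; have cpsi' := lipschitz_continuousR p3.
have c1 : continuous (fun x => psi (phi x)).
  by move=> x; apply: continuous_comp; [exact: bphi.1|exact: cpsi].
have c2 : continuous (fun x => psi' (phi x)).
  by move=> x; apply: continuous_comp; [exact: bphi.1|exact: cpsi'].
have T := taylor1M (taylor1_comp C0 p1 p2 p4 (test_function_taylor1 i tphi))
  (test_function_taylor1 i tchi).
have bf : bcfun (fun x => psi (phi x) * chi x).
  by apply: (bcfunM (M := C)) => // x; exact: (p1 _).1.
have [_ [K [rK HK]]] := bphi'.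
have bf1 : bcfun (fun x => psi' (phi x) * partial i phi x * chi x).
  apply: (bcfunM (M := C * K)) => //.
    by move=> x; exact: cvgM (c2 x) (bphi'.1 x).
  move=> x; rewrite normrM; apply: ler_pM => //; [exact: (p1 _).2|exact: (HK x).1].
have bf2 : bcfun (fun x => psi (phi x) * partial i chi x).
  by apply: (bcfunM (M := C)) => // x; exact: (p1 _).1.
have bf' : bcfun (fun x => psi' (phi x) * partial i phi x * chi x + psi (phi x)
  * partial i chi x).
  have := bcfunB bf1 (bcfunZ (-1) bf2); congr bcfun; apply/funext => x.
  by rewrite mulN1r opprK.
have := Rintegral_derivative0 bf bf' T.
rewrite (@Rintegral_supported _ _ Omega).
  by move=> <-; apply: eq_Rintegral => x _; rewrite addrC.
move=> x; have [c0|c0] := eqVneq (chi x) 0; last by move=> _;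
  exact: test_function_support tchi c0.
rewrite c0 mulr0 add0r mulf_eq0 negb_or => /andP[_].
exact: (test_function_support tchi').
Qed.

Lemma measurable_comp_continuousR (f : R -> R) v : continuous f -> measurable_fun Omega v ->
  measurable_fun Omega (fun x => f (v x)).
Proof.
by move=> cf mv; apply: (measurableT_comp (f := f)) => //; exact: continuous_measurable_fun.
Qed.

Lemma W0_approx_chain (i : 'I_n) v G chi (C : R) (psi psi' : R -> R) :
  lipschitz_C1 C psi psi' -> W0_approx Omega v G -> test_function Omega chi ->
  \int[leb]_(x in Omega) (psi (v x) * partial i chi x + psi' (v x) * G x 0 i * chi x) = 0.
Proof.
move=> nice [sv sG Hv] tchi; have [C0 p1 p2 p3 p4] := nice.
have cpsi := lipschitz_continuousR p2; have cpsi' := lipschitz_continuousR p3.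
have tchi' := test_function_partial i tchi.
have bchi := test_function_bcfun tchi; have bchi' := test_function_bcfun tchi'.
have [_ [K1 [rK1 HK1]]] := bchi; have [_ [K2 [rK2 HK2]]] := bchi'.
pose K := Num.max K1 K2.
have HK x : `|chi x| <= K /\ `|partial i chi x| <= K.
  by rewrite !le_max (HK1 x).1 (HK2 x).1 orbT.
have K0 : 0 <= K by apply: le_trans (normr_ge0 _) (HK 0).1.
have sqc := test_function_sqint Omega_open Omega_bounded tchi.
have sqc' := test_function_sqint Omega_open Omega_bounded tchi'.
have iF (w : 'rV[R]_n -> R) (H : 'rV[R]_n -> R) : sqi w -> sqi H ->
    leb.-integrable Omega (EFin \o (fun x => psi (w x) * partial i chi x + psi' (w x)
      * H x * chi x)).
  move=> sw sH; have m1 := measurable_comp_continuousR cpsi sw.1.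
  have m2 := measurable_comp_continuousR cpsi' sw.1.
  apply: integrableDR => //.
    have s1 : sqi (fun x => psi (w x)).
      by apply: (sqint_bounded mO Ofin (K := C) m1) => x _; exact: (p1 _).1.
    exact: (sqintM mO s1 sqc').
  rewrite (_ : (fun x => _) = (fun x => (psi' (w x) * chi x) * H x)); last first.
    by apply/funext => x; ring.
  have s3 : sqi (fun x => psi' (w x) * chi x).
    apply: (sqint_bounded mO Ofin (K := C * K)); first exact: measurable_funM m2 sqc.1.
    by move=> x _; rewrite normrM; apply: ler_pM => //; [exact: (p1 _).2|exact: (HK x).1].
  exact: (sqintM mO s3 sH).
have iFv := iF _ _ sv (sG i).
pose V := fine (leb Omega); pose g2 := \int[leb]_(x in Omega) G x 0 i ^+ 2.
apply/eqP; rewrite -normr_eq0 eq_le normr_ge0 andbT.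
(* The constant is read off from the integral of [bnd] below, whose last term is at most 3 d^-1 (2
   d^2) = 6 d. *)
apply: (@le_small_error _ _ _ (C * K * (2 * (V + g2) + 6)) 1) => // d /andP[d0 d1].
rewrite add0r.
have d20 : 0 < d ^+ 2 by rewrite exprn_gt0.
have [phi tphi [phi1 /(_ i) phi2]] := Hv _ d20.
have tphi' := test_function_partial i tphi.
have sp := test_function_sqint Omega_open Omega_bounded tphi.
have sp' := test_function_sqint Omega_open Omega_bounded tphi'.
have iFp := iF _ _ sp sp'.
have sa : sqi (fun x => v x - phi x) by exact: (sqintB mO sv sp).
have sb : sqi (fun x => G x 0 i - partial i phi x) by exact: (sqintB mO (sG i) sp').
rewrite -[X in `|X|]subr0 -(test_function_chain i nice tphi tchi) -RintegralB//.
apply: le_trans (le_normr_Rintegral mO _) _; first exact: integrableBR.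
pose bnd x := (C * K) * (2 * d * (1 + G x 0 i ^+ 2) +
   3 * d^-1 * ((v x - phi x) ^+ 2 + (G x 0 i - partial i phi x) ^+ 2)).
have i1 : leb.-integrable Omega (EFin \o cst (1 : R)) by exact: integrable_cst_lty.
have iG2 := (sG i).2. have ia2 := sa.2. have ib2 := sb.2.
have ib1 : leb.-integrable Omega (EFin \o (fun x => 2 * d * (1 + G x 0 i ^+ 2))).
  by apply: integrableZR => //; exact: integrableDR.
have ib3 : leb.-integrable Omega (EFin \o (fun x => 3 * d^-1 * ((v x - phi x)
  ^+ 2 + (G x 0 i - partial i phi x) ^+ 2))).
  by apply: integrableZR => //; exact: integrableDR.
apply: (@le_trans _ _ (\int[leb]_(x in Omega) bnd x)).
  apply: le_Rintegral => //.
  - by apply: integrable_normR; exact: integrableBR.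
  - by apply: integrableZR => //; exact: integrableDR.
  move=> x _; rewrite /bnd.
  set a := v x - phi x; set b := G x 0 i - partial i phi x; set g := G x 0 i.
  (* Writing the derivative of phi as g - b makes each term carry a factor a or b, which is small in
     L^2. *)
  have -> : psi (v x) * partial i chi x + psi' (v x) * g * chi x -
      (psi (phi x) * partial i chi x + psi' (phi x) * partial i phi x * chi x) =
      (psi (v x) - psi (phi x)) * partial i chi x + (psi' (v x) * chi x * b +
      (psi' (v x) - psi' (phi x)) * chi x * (g - b)).
    by rewrite /b /g; ring.
  apply: (@le_trans _ _ (C * K * (`|a| + (`|b| + (`|a * g| + `|a * b|))))).
    rewrite [leRHS](_ : _ =
      C * K * `|a| + (C * K * `|b| + C * K * (`|a * g| + `|a * b|))); last by ring.
    apply: le_trans (ler_normD _ _) _; apply: lerD.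
      by rewrite normrM mulrAC; apply: ler_pM => //; exact: (HK x).2.
    apply: le_trans (ler_normD _ _) _; apply: lerD.
      rewrite !normrM; apply: ler_wpM2r => //; apply: ler_pM => //.
        exact: (p1 _).2.
      exact: (HK x).1.
    rewrite normrM normrM.
    apply: (@le_trans _ _ ((C * `|a|) * K * (`|g| + `|b|))).
      apply: ler_pM => //; last exact: ler_normB.
      by apply: ler_pM => //; exact: (HK x).1.
    by rewrite !normrM -mulrDr (mulrAC C) mulrA.
  apply: ler_wpM2l; first exact: mulr_ge0.
  have y1 := young 1 a d0; have y2 := young 1 b d0.
  have y1' : `|a| <= d + d^-1 * a ^+ 2 by move: y1; rewrite mul1r expr1n mulr1.
  have y2' : `|b| <= d + d^-1 * b ^+ 2 by move: y2; rewrite mul1r expr1n mulr1.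
  have y3 := young g a d0; rewrite mulrC in y3.
  have y4 := young a b (@ltr01 R); rewrite invr1 !mul1r in y4.
  have dV : 1 <= d^-1 by rewrite invf_ge1.
  have a20 := sqr_ge0 a; have b20 := sqr_ge0 b; have g20 := sqr_ge0 g.
  have h1 : a ^+ 2 <= d^-1 * a ^+ 2 by rewrite ler_peMl.
  have h2 : b ^+ 2 <= d^-1 * b ^+ 2 by rewrite ler_peMl.
  have h3 : 0 <= d * g ^+ 2 by rewrite mulr_ge0// ltW.
  lra.
rewrite RintegralZl//; last by exact: integrableDR.
rewrite -[leRHS]mulrA; apply: ler_wpM2l; first exact: mulr_ge0.
rewrite RintegralD// !RintegralZl//; [|exact: integrableDR|exact: integrableDR].
rewrite RintegralD// [X in _ + _ * X <= _]RintegralD// Rintegral_cst// mul1r -/V -/g2.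
have H6 : d^-1 * ((\int[leb]_(x in Omega) (v x - phi x) ^+ 2) +
   \int[leb]_(x in Omega) (G x 0 i - partial i phi x) ^+ 2) <= 2 * d.
  rewrite ler_pdivrMl//; lra.
lra.
Qed.

(** Take psi = [scaled_bump c N] in the chain rule. The psi term is O(1/N), while psi' tends to the
    indicator of c, with [bump'] bounded by 1 for dominated convergence. *)
Lemma W0_approx_level_set (i : 'I_n) v G chi (c : R) :
  W0_approx Omega v G -> test_function Omega chi ->
  \int[leb]_(x in Omega) ((v x == c)%:R * (G x 0 i * chi x)) = 0.
Proof.
move=> W tchi; have [sv sG _] := W; have sG' := sG i.
have tchi' := test_function_partial i tchi.
have [_ [K [rK HK]]] := test_function_bcfun tchi'.
have sqc := test_function_sqint Omega_open Omega_bounded tchi.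
have sqc' := test_function_sqint Omega_open Omega_bounded tchi'.
have iGc : leb.-integrable Omega (EFin \o (fun x => G x 0 i * chi x)).
  exact: (sqintM mO sG' sqc).
have N1 k : (1 : R) <= k.+1%:R by rewrite ler1n.
pose F k x := (scaled_bump' c k.+1%:R (v x) * (G x 0 i * chi x) : R).
have mb k : measurable_fun Omega (fun x => scaled_bump' c k.+1%:R (v x)).
  have [_ _ _ H _] := scaled_bump_nice c (N1 k).
  by apply: measurable_comp_continuousR sv.1; exact: lipschitz_continuousR H.
have mb0 k : measurable_fun Omega (fun x => scaled_bump c k.+1%:R (v x)).
  have [_ _ H _ _] := scaled_bump_nice c (N1 k).
  by apply: measurable_comp_continuousR sv.1; exact: lipschitz_continuousR H.
have mGc := integrable_measurableR iGc.
have mF k : measurable_fun Omega (F k) by exact: measurable_funM.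
have cF x : F k x @[k --> \oo] --> (v x == c)%:R * (G x 0 i * chi x).
  by apply: cvgM; [exact: scaled_bump'_cvg|exact: cvg_cst].
have mlim : measurable_fun Omega (fun x => (v x == c)%:R * (G x 0 i * chi x)).
  by apply: (measurable_fun_cvg mF) => x _; exact: cF.
have [|||_ _ IF] := @dominated_convergence _ _ _ leb Omega mO (fun k => EFin \o F k)
  (EFin \o (fun x => (v x == c)%:R * (G x 0 i * chi x)))
  (EFin \o (fun x => `|G x 0 i * chi x|))
  (fun k => (measurable_EFinP _ _).2 (mF k)) ((measurable_EFinP _ _).2 mlim).
- by apply: aeW => x _; apply: cvg_EFin; [exact: nearW|exact: cF].
- exact: integrable_normR.
- apply: aeW => x k _ /=; rewrite lee_fin /F normrM.
  by rewrite ler_piMl//; exact: bump'_le1.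
have IF0 k : `|\int[leb]_(x in Omega) F k x| <= (K * fine (leb Omega)) / k.+1%:R.
  have iF1 : leb.-integrable Omega (EFin \o F k).
    apply: (le_integrableR mO (g := fun x => `|G x 0 i * chi x|) (mF k)).
      by move=> x _; rewrite normrM ler_piMl//; exact: bump'_le1.
    exact: integrable_normR.
  have sb : sqi (fun x => scaled_bump c k.+1%:R (v x)).
    apply: (sqint_bounded mO Ofin (K := k.+1%:R^-1)) => // x _.
    exact: scaled_bump_le.
  have iS : leb.-integrable Omega (EFin \o (fun x => scaled_bump c k.+1%:R (v x)
    * partial i chi x)).
    exact: (sqintM mO sb sqc').
  have := W0_approx_chain i (scaled_bump_nice c (N1 k)) W tchi.
  rewrite (_ : \int[leb]_(x in Omega) _ =
    \int[leb]_(x in Omega) (scaled_bump c k.+1%:R (v x) * partial i chi x + F k x));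
      last first.
    by apply: eq_Rintegral => x _; rewrite /F mulrA.
  rewrite RintegralD// => /eqP; rewrite addrC addr_eq0 => /eqP ->; rewrite normrN.
  apply: le_trans (le_normr_Rintegral mO iS) _.
  rewrite mulrAC -(Rintegral_cst leb mO); apply: le_Rintegral => //.
  - exact: integrable_normR.
  - exact: integrable_cst_lty.
  - move=> x _; rewrite normrM mulrC; apply: ler_pM => //; first exact: (HK x).1.
    exact: scaled_bump_le.
have C1 : (\int[leb]_(x in Omega) F k x) @[k --> \oo] -->
    \int[leb]_(x in Omega) ((v x == c)%:R * (G x 0 i * chi x)).
  apply: fine_cvg; rewrite /Rintegral fineK; first exact: IF.
  apply: integrable_fin_num => //.
  apply: (le_integrableR mO (g := fun x => `|G x 0 i * chi x|) mlim).
    move=> x _; rewrite normrM ler_piMl//; case: eqP => _; rewrite ?normr1 ?normr0//.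
  exact: integrable_normR.
have C2 : (\int[leb]_(x in Omega) F k x) @[k --> \oo] --> (0 : R).
  apply: norm_cvg0; apply: (@squeeze_cvgr _ _ _ _ (cst 0)
    (fun k => (K * fine (leb Omega)) / k.+1%:R)).
  - by apply: nearW => k; rewrite normr_ge0 IF0.
  - exact: cvg_cst.
  - rewrite -[X in _ --> X](mulr0 (K * fine (leb Omega))).
    by apply: cvgM; [exact: cvg_cst|exact: cvg_harmonic].
exact: cvg_unique C1 C2.
Qed.

(* The components of G are themselves L^2 limits of test functions. *)
Lemma W0_approx_gradient_level_set v G (c : R) (i : 'I_n) : W0_approx Omega v G ->
  {ae leb, forall x, Omega x -> v x = c -> G x 0 i = 0}.
Proof.
move=> W; have [sv sG Hv] := W.
pose f x := (v x == c)%:R * G x 0 i ^+ 2.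
have iG2 := (sG i).2.
have mI : measurable_fun Omega (fun x => (v x == c)%:R : R).
  rewrite (_ : (fun x => _) = (\1_[set c] : R -> R) \o v).
    apply: (measurableT_comp (f := (\1_[set c] : R -> R))); last exact: sv.1.
    exact: measurable_indic.
  apply/funext => x /=; rewrite indicE; congr (nat_of_bool _)%:R.
  by apply/eqP/idP => [->|]; rewrite ?inE.
have f0 x : 0 <= f x by rewrite mulr_ge0 ?sqr_ge0.
have fle x : f x <= G x 0 i ^+ 2 by rewrite /f; case: eqP => _;
  rewrite ?mul1r ?mul0r ?sqr_ge0.
have If : leb.-integrable Omega (EFin \o f).
  have mf : measurable_fun Omega f by exact: (measurable_funM mI (measurable_funX 2 (sG
    i).1)).
  apply: (le_integrableR mO (g := fun x => G x 0 i ^+ 2) mf); last exact: iG2.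
  by move=> x _; rewrite ger0_norm.
have I0 : \int[leb]_(x in Omega) f x = 0.
  apply/eqP; rewrite eq_le Rintegral_ge0 ?andbT//.
  apply: (@le_small_error _ _ _ ((\int[leb]_(x in Omega) G x 0 i ^+ 2) + 1) 1)
    => // d /andP[d0 d1].
  rewrite add0r; have d20 : 0 < d ^+ 2 by rewrite exprn_gt0.
  have [phi tphi [_ /(_ i) phi2]] := Hv _ d20.
  have tphi' := test_function_partial i tphi.
  have sp := test_function_sqint Omega_open Omega_bounded tphi'.
  have sb : sqi (fun x => G x 0 i - partial i phi x) by exact: (sqintB mO (sG i) sp).
  (* Testing with the partial derivative of phi allows G_i^2 to be replaced by G_i (G_i - D_i phi)
     on the level set, which Young's inequality makes small. *)
  have L0 := W0_approx_level_set i c W tphi'.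
  have i1 : leb.-integrable Omega (EFin \o (fun x => (v x == c)%:R * (G x 0 i * partial
    i phi x))).
    have iGp := sqintM mO (sG i) sp.
    have mp := measurable_funM mI (integrable_measurableR iGp).
    apply: (le_integrableR mO (g := fun x => `|G x 0 i * partial i phi x|) mp).
      by move=> x _; rewrite normrM ler_piMl//; case: eqP => _; rewrite ?normr1 ?normr0.
    exact: integrable_normR.
  rewrite -[leLHS]subr0 -L0 -RintegralB//.
  apply: (@le_trans _ _ (\int[leb]_(x in Omega) `|G x 0 i * (G x 0 i - partial i phi x)|)).
    apply: le_Rintegral => //; first exact: integrableBR.
      exact: (integrable_normR (sqintM mO (sG i) sb)).
    move=> x _; rewrite /f -mulrBr (_ : _ - _ = G x 0 i * (G x 0 i - partial i phi x));
      last by ring.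
    by case: eqP => _; rewrite ?mul1r ?mul0r//; exact: ler_norm.
  apply: le_trans (Rintegral_young mO d0 (sG i) sb) _.
  have : d^-1 * (\int[leb]_(x in Omega) (G x 0 i - partial i phi x) ^+ 2) <= d.
    by rewrite ler_pdivrMl// -expr2.
  lra.
have mEf : measurable_fun Omega (EFin \o f) by exact: measurable_int If.
have : (\int[leb]_(x in Omega) `|(EFin \o f) x| = 0)%E.
  transitivity (\int[leb]_(x in Omega) (f x)%:E)%E.
    by apply: eq_integral => x _ /=; rewrite ger0_norm.
  by rewrite -[LHS]fineK;
    [rewrite -[fine _]/(Rintegral leb Omega f) I0|exact: integrable_fin_num].
move/(ae_eq_integral_abs leb mO mEf).
apply: filterS => x H Ox vc; have := H Ox.
rewrite /= /f vc eqxx mul1r => -[] /eqP; rewrite sqrf_eq0 => /eqP //.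
Qed.

End level_sets.

(** * Integrals of weak L^m functions *)

Section integral_nonmeasurable.
Context d (T : measurableType d) (R : realType).
Variables (mu : {measure set T -> \bar R}).
Local Open Scope ereal_scope.

(* No measurability is assumed on the upper bound: it is applied to a(x, u) Du.G, where
   the measurability of a(x, u) would require the Caratheodory argument. *)
Lemma ge0_le_integral_nonmeasurable (D : set T) (f g : T -> \bar R) :
  (forall x, D x -> 0 <= f x) -> (forall x, D x -> f x <= g x) ->
  \int[mu]_(x in D) f x <= \int[mu]_(x in D) g x.
Proof.
move=> f0 fg; have g0 x : D x -> 0 <= g x.
  by move=> Dx; apply: le_trans (f0 _ Dx) (fg _ Dx).
rewrite !ge0_integralE//; apply: le_ereal_sup => _ [h hf <-]; exists h => // x.
apply: le_trans (hf x) _; rewrite !patchE; case: ifPn => // /set_mem; exact: fg.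
Qed.

(** Restricting f to the complement of the null set N keeps its integral and makes the comparison
    with the positive part of g hold everywhere. *)
Lemma ae_le_integral_nonmeasurable (D : set T) (f g : T -> \bar R) : measurable D ->
  measurable_fun D f -> (forall x, D x -> 0 <= f x) ->
  {ae mu, forall x, D x -> f x <= g x} ->
  \int[mu]_(x in D) f x <= \int[mu]_(x in D) g x.
Proof.
move=> mD mf f0 [N [mN N0 fgN]].
have fg x : D x -> ~ N x -> f x <= g x.
  by move=> Dx; apply: contra_notP => fg; apply: fgN => /(_ Dx).
have mCN : measurable (~` N) by exact: measurableC.
rewrite [leRHS]integralE.
(* g can be negative only on N, so its negative part is dominated by +oo on N, which has integral
   0. *)
have -> : \int[mu]_(x in D) g^\- x = 0.
  apply/eqP; rewrite eq_le integral_ge0// andbT.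
  apply: (@le_trans _ _ (\int[mu]_(x in D) ((cst +oo) \_ N) x)).
    apply: ge0_le_integral_nonmeasurable => // x Dx; rewrite patchE; case: ifPn => [_|].
      exact: leey.
    rewrite notin_setE => /(fg _ Dx) fgx; rewrite funenegE.
    have g0 := le_trans (f0 _ Dx) fgx.
    by rewrite ge_max lexx andbT leeNl oppe0.
  rewrite -integral_mkcondr integral_cst; last exact: measurableI.
  rewrite (_ : mu (D `&` N) = 0) ?mule0//.
  apply/eqP; rewrite eq_le measure_ge0 andbT -N0.
  by apply: le_measure; rewrite ?inE//; exact: measurableI.
rewrite sube0; apply: (@le_trans _ _ (\int[mu]_(x in D) (f \_ (~` N)) x)).
  rewrite le_eqVlt; apply/orP; left; apply/eqP; apply: ge0_ae_eq_integral => //.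
  - apply/(measurable_restrict _ mCN mD).1.
    by apply: measurable_funS mf => // x [].
  - by move=> x Dx; rewrite patchE; case: ifP => // _; exact: f0.
  - exists N; split => // x /= H; apply: contrapT => Nx; apply: H => Dx.
    by rewrite patchE mem_set.
apply: ge0_le_integral_nonmeasurable => x Dx; rewrite patchE.
  by case: ifP => // _; exact: f0.
case: ifPn => [/set_mem Nx|_]; last exact: funepos_ge0.
by rewrite funeposE le_max (fg _ Dx Nx).
Qed.

End integral_nonmeasurable.

Section weak_Lebesgue.
Context d (T : measurableType d) (R : realType).
Variables (mu : {measure set T -> \bar R}) (D : set T).
Hypothesis mD : measurable D.

Lemma dyadic_le (x : R) : exists j : nat, x <= 2 ^+ j.
Proof.
exists (Num.truncn x).+1.
apply: le_trans (ltW (truncnS_gt _)) _.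
by rewrite -natrX ler_nat ltnW// ltn_expl.
Qed.

(* Split A into {|f| <= l} and the dyadic shells {2^j l < |f| <= 2^(j+1) l}. *)
Lemma weak_integral_dyadic (f : T -> R) (m gamma a l : R) (A : set T) : 1 < m ->
  measurable_fun D f -> 0 <= gamma ->
  (forall lambda : R, 0 < lambda ->
    (mu (D `&` [set x | (lambda < `|f x|)%R]) <= (gamma / lambda `^ m)%:E)%E) ->
  measurable A -> A `<=` D -> mu A = a%:E -> 0 < l ->
  (\int[mu]_(x in A) (`|f x|)%:E <=
    (l * a + 2 * gamma * l `^ (1 - m) / (1 - 2 `^ (1 - m)))%:E)%E.
Proof.
move=> m1 mf g0 wf mA AD Aa l0.
have mfA : measurable_fun A (fun x => `|f x|).
  by apply: measurableT_comp => //; exact: measurable_funS mf.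
pose q : R := 2 `^ (1 - m).
have q0 : 0 < q by rewrite powR_gt0.
have q1 : q < 1.
  by rewrite /q /powR gt_eqF// expR_lt1 nmulr_rlt0 ?subr_lt0// ln_gt0// ltr1n.
pose S j := A `&` [set x | `|f x| <= 2 ^+ j * l].
have mS j : measurable (S j).
  rewrite /S (_ : [set x | `|f x| <= 2 ^+ j * l] =
    (fun x => `|f x|) @^-1` `]-oo, 2 ^+ j * l]%classic).
    exact: mfA.
  by apply/seteqP; split => x /=; rewrite in_itv.
pose c := 2 * gamma * l `^ (1 - m).
have c0 : 0 <= c by rewrite !mulr_ge0// powR_ge0.
(* On shell j, |f| <= 2^(j+1) l and the measure is at most gamma / (2^j l)^m, a contribution of c
   q^j. *)
have SJ J : (\int[mu]_(x in S J) (`|f x|)%:E <= (l * a + series (geometric c q) J)%:E)%E.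
  elim: J => [|J IH].
    rewrite /series /= big_geq// addr0.
    apply: (@le_trans _ _ (\int[mu]_(x in S 0%N) (cst l%:E x))%E).
      apply: ge0_le_integral_nonmeasurable => // x [_ /=].
      by rewrite expr0 mul1r lee_fin.
    rewrite integral_cst// EFinM lee_wpmul2l ?lee_fin ?(ltW l0)// -Aa.
    by apply: le_measure; rewrite ?inE//; exact: subIsetl.
  pose B := A `&` [set x | 2 ^+ J * l < `|f x| <= 2 ^+ J.+1 * l].
  have mB : measurable B.
    rewrite /B (_ : [set x | _] =
      (fun x => `|f x|) @^-1` `]2 ^+ J * l, 2 ^+ J.+1 * l]%classic).
      exact: mfA.
    by apply/seteqP; split => x /=; rewrite in_itv.
  have l2J : 0 < 2 ^+ J * l by rewrite mulr_gt0// exprn_gt0.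
  have -> : S J.+1 = S J `|` B.
    apply/seteqP; split => x /=.
      move=> [Ax fx]; have [?|?] := leP `|f x| (2 ^+ J * l); first by left.
      by right; split => //=; apply/andP.
    move=> [[Ax fx]|[Ax /andP[_ fx]]]; split => //.
    apply: le_trans fx _; rewrite exprS ler_pM2r// ler_peMl ?exprn_ge0//; lra.
  rewrite ge0_integral_setU//; first last.
  - apply/disj_setPS => x [[_ /= fx] [_ /= /andP[]]]; by rewrite ltNge fx.
  - apply/measurable_EFinP; apply: measurable_funS mfA => //.
    by move=> x [[]|[]].
  rewrite (_ : l * a + series (geometric c q) J.+1 =
    l * a + series (geometric c q) J + geometric c q J); last first.
    by rewrite /series /= big_nat_recr//= addrA.
  rewrite EFinD; apply: leeD => //.
  apply: (@le_trans _ _ (\int[mu]_(x in B) (cst (2 ^+ J.+1 * l)%:E x))%E).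
    by apply: ge0_le_integral_nonmeasurable => // x [_ /= /andP[_]]; rewrite lee_fin.
  rewrite integral_cst//.
  apply: (@le_trans _ _ ((2 ^+ J.+1 * l)%:E * (gamma / (2 ^+ J * l) `^ m)%:E)%E).
    rewrite lee_wpmul2l ?lee_fin ?mulr_ge0 ?exprn_ge0 ?(ltW l0)//.
    apply: le_trans (wf _ l2J); apply: le_measure; rewrite ?inE//.
      rewrite (_ : [set x | _] = (fun x => `|f x|) @^-1` `]2 ^+ J * l, +oo[%classic).
        have mfD : measurable_fun D (fun x => `|f x|) by exact: measurableT_comp.
        exact: mfD.
      by apply/seteqP; split => x /=; rewrite in_itv /= andbT.
    by move=> x [/AD ? /= /andP[]].
  rewrite -EFinM lee_fin /geometric /= /c /q.
  have -> : (2 `^ (1 - m)) ^+ J = (2 ^+ J) `^ (1 - m) :> R.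
    by rewrite -(powR_mulrn J (powR_ge0 2 (1 - m))) -powRrM mulrC powRrM powR_mulrn.
  rewrite [X in _ <= X](_ : _ = 2 * gamma * (2 ^+ J * l) `^ (1 - m)); last first.
    by rewrite powRM ?exprn_ge0 ?(ltW l0)//; ring.
  have -> : (2 ^+ J * l) `^ (1 - m) = (2 ^+ J * l) / (2 ^+ J * l) `^ m.
    rewrite powRB; first by rewrite powRr1// ltW.
    by rewrite (gt_eqF l2J) implybT.
  rewrite exprS le_eqVlt; apply/orP; left; apply/eqP.
  by set X := 2 ^+ J; set Y := (_ `^ m)^-1; ring.
have SU : \bigcup_j S j = A.
  apply/seteqP; split => [x [j _ []]//|x Ax].
  have [j Hj] := dyadic_le (`|f x| / l).
  by exists j => //; split => //=; rewrite -ler_pdivrMr.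
rewrite -SU; have ndS : nondecreasing_seq S.
  apply/nondecreasing_seqP => j; apply/subsetPset => x [Ax /= fx]; split => //=.
  apply: le_trans fx _; rewrite exprS ler_pM2r// ler_peMl ?exprn_ge0//; lra.
have mfS j : measurable_fun (S j) (EFin \o (fun x => `|f x|)).
  by apply/measurable_EFinP; apply: measurable_funS mfA => // x [].
have cv := @ge0_nondecreasing_set_cvg_integral _ _ _ S (EFin \o (fun x => `|f x|))
  mu ndS mS mfS
  (fun _ x _ => normr_ge0 (f x)).
rewrite -(cvg_lim (@ereal_hausdorff R) cv); apply: lime_le; first exact: cvgP cv.
apply: nearW => J; apply: le_trans (SJ J) _; rewrite lee_fin lerD2l.
by apply: geometric_le_lim => //; rewrite gtr0_norm.
Qed.

End weak_Lebesgue.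

(** * Decay of the distribution function *)

(** M >= V starts the induction and C 2^s M^q <= M closes it; the exponents match because s (1 - q)
    + s q = s. *)
Lemma dyadic_decay (R : realType) (Phi : nat -> R) (C V s q : R) :
  0 <= C -> 0 < q < 1 -> 0 <= V ->
  (forall j, 0 <= Phi j <= V) ->
  (forall j, Phi j.+1 <= C * (2 ^+ j) `^ (- (s * (1 - q))) * Phi j `^ q) ->
  exists2 M : R, 0 <= M & forall j, Phi j <= M * (2 ^+ j) `^ (- s).
Proof.
move=> C0 /andP[q0 q1] V0 HV Hstep.
have q10 : 0 < 1 - q by rewrite subr_gt0.
pose M := Num.max V ((C * 2 `^ s) `^ (1 - q)^-1).
have M0 : 0 <= M by rewrite le_max V0.
have CM : C * 2 `^ s <= M `^ (1 - q).
  have C20 : 0 <= C * 2 `^ s by rewrite mulr_ge0// powR_ge0.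
  rewrite [leLHS](_ : _ = ((C * 2 `^ s) `^ (1 - q)^-1) `^ (1 - q)); last first.
    by rewrite -powRrM mulVf ?gt_eqF// powRr1.
  apply: ge0_ler_powR; rewrite ?nnegrE ?powR_ge0 ?(ltW q10)//.
  by rewrite le_max lexx orbT.
exists M => //; elim=> [|j IH].
  have /andP[_ /le_trans] := HV 0%N; apply.
  by rewrite expr0 powR1 mulr1 le_max lexx.
have /andP[Pj0 _] := HV j.
set x : R := 2 ^+ j in IH *.
have x0 : 0 < x by rewrite exprn_gt0.
apply: le_trans (Hstep j) _; rewrite -/x.
apply: (@le_trans _ _ (C * x `^ (- (s * (1 - q))) * (M * x `^ (- s)) `^ q)).
  rewrite ler_wpM2l ?mulr_ge0 ?powR_ge0//.
  by apply: ge0_ler_powR; rewrite ?nnegrE ?mulr_ge0 ?powR_ge0// ltW.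
rewrite powRM ?powR_ge0// -powRrM exprS powRM ?(ltW x0)//.
have -> : C * x `^ (- (s * (1 - q))) * (M `^ q * x `^ (- s * q)) =
    C * M `^ q * (x `^ (- (s * (1 - q))) * x `^ (- s * q)) by ring.
rewrite -powRD; last by rewrite (gt_eqF x0) implybT.
have -> : - (s * (1 - q)) + - s * q = - s by ring.
rewrite mulrA ler_wpM2r ?powR_ge0//.
have MM : M = M `^ q * M `^ (1 - q).
  rewrite -powRD; first by rewrite addrC subrK powRr1.
  by rewrite addrC subrK oner_eq0.
rewrite [in leRHS]MM mulrC -mulrA ler_wpM2l ?powR_ge0//.
by rewrite powRN ler_pdivlMr ?powR_gt0.
Qed.

(* With b = |B_k| and t = k^((1+theta)/2) b^(-1/(2m)), the two terms n t b and S / t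
   of Young's inequality have the same order. *)
Lemma balance_exponents (R : realType) (n : nat) (m theta k b c S A : R) : (0 < n)%N ->
  0 < m -> 0 <= theta -> 1 <= k -> 0 < b -> 0 <= A ->
  S <= A * k `^ (1 + theta) * b `^ (1 - m^-1) ->
  (forall t r, 0 < t -> 0 < r -> 4 * b < r ^+ n ->
     k / 8 * c <= r * (n%:R * (t * b) + t^-1 * S)) ->
  c <= 8 * 5 `^ n%:R^-1 * (n%:R + A) *
    k `^ (- ((1 - theta) / 2)) * b `^ (1 + n%:R^-1 - (2 * m)^-1).
Proof.
move=> n0 m0 th0 k1 b0 A0 HS H.
have k0 : 0 < k by lra.
pose t := k `^ ((1 + theta) / 2) * b `^ (- (2 * m)^-1).
have t0 : 0 < t by rewrite mulr_gt0 ?powR_gt0.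
(* The factor 5 makes 4 b < r^n strict. *)
pose r := (5 * b) `^ n%:R^-1.
have b5 : 0 < 5 * b by lra.
have r0 : 0 < r by rewrite powR_gt0.
have nR : (n%:R : R) != 0 by rewrite pnatr_eq0 -lt0n.
have rn : r ^+ n = 5 * b.
  by rewrite -powR_mulrn ?(ltW r0)// -powRrM mulVf// powRr1// ltW.
have := H t r t0 r0; rewrite rn => /(_ _) Hk.
have {Hk} Hk : k / 8 * c <= r * (n%:R * (t * b) + t^-1 * S) by apply: Hk; lra.
pose X := k `^ ((1 + theta) / 2) * b `^ (1 - (2 * m)^-1).
have tb : t * b = X.
  have Eb : b `^ (1 - (2 * m)^-1) = b * b `^ (- (2 * m)^-1).
    rewrite powRD; first by rewrite powRr1// ltW.
    by rewrite (gt_eqF b0) implybT.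
  by rewrite /t /X Eb mulrAC mulrA.
have tS : t^-1 * S <= A * X.
  apply: (@le_trans _ _ (t^-1 * (A * k `^ (1 + theta) * b `^ (1 - m^-1)))).
    by rewrite ler_pM2l// invr_gt0.
  rewrite mulrC ler_pdivrMr// /t /X.
  have -> : A * (k `^ ((1 + theta) / 2) * b `^ (1 - (2 * m)^-1)) *
     (k `^ ((1 + theta) / 2) * b `^ (- (2 * m)^-1)) =
     A * (k `^ ((1 + theta) / 2) * k `^ ((1 + theta) / 2)) *
     (b `^ (1 - (2 * m)^-1) * b `^ (- (2 * m)^-1)) by ring.
  rewrite -!powRD ?(gt_eqF k0) ?(gt_eqF b0) ?implybT//.
  have -> : (1 + theta) / 2 + (1 + theta) / 2 = 1 + theta by field.
  have -> : 1 - (2 * m)^-1 + - (2 * m)^-1 = 1 - m^-1 by field; rewrite gt_eqF.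
  by [].
have Hk2 : k / 8 * c <= r * ((n%:R + A) * X).
  by apply: le_trans Hk _; rewrite ler_pM2l// tb [leRHS]mulrDl lerD2l.
have : c <= 8 * (k^-1 * (r * ((n%:R + A) * X))).
  rewrite -(ler_pM2l (_ : 0 < k / 8)); last by rewrite divr_gt0.
  apply: le_trans Hk2 _; rewrite le_eqVlt; apply/orP; left; apply/eqP.
  by field; rewrite gt_eqF.
move/le_trans; apply; rewrite le_eqVlt; apply/orP; left; apply/eqP.
rewrite /r /X powRM ?(ltW b0)//.
have -> : k `^ (- ((1 - theta) / 2)) = k^-1 * k `^ ((1 + theta) / 2).
  rewrite -(powR_inv1 (ltW k0)) -powRD; last by rewrite (gt_eqF k0) implybT.
  by congr (_ `^ _); field.
have -> : b `^ (1 + n%:R^-1 - (2 * m)^-1) = b `^ n%:R^-1 * b `^ (1 - (2 * m)^-1).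
  rewrite -powRD; last by rewrite (gt_eqF b0) implybT.
  by congr (_ `^ _); ring.
ring.
Qed.

Section truncations.
Context {R : realType}.

Lemma truncationB (k l s : R) : 0 < k -> 0 < l ->
  truncation l (s - truncation k s) = truncation (k + l) s - truncation k s.
Proof.
move=> k0 l0; rewrite /truncation !minElt !maxElt.
by do ?case: ifP => /=; rewrite ?ltNge => *; lra.
Qed.

Lemma truncation_bound (l s : R) : 0 <= l -> `|truncation l s| <= l.
Proof. by move=> l0; rewrite ler_norml /truncation le_max lexx /= ge_max ge_min lexx
  orbT andbT; lra. Qed.

Lemma truncation_id (l s : R) : `|s| <= l -> truncation l s = s.
Proof.
rewrite ler_norml => /andP[h1 h2]; rewrite /truncation.
by rewrite (min_idPl h2) (max_idPr h1).
Qed.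

Lemma truncation_eqr (l s : R) : 0 <= l -> l <= s -> truncation l s = l.
Proof. by move=> l0 ls; rewrite /truncation (min_idPr ls); apply/max_idPr; lra. Qed.

Lemma truncation_eql (l s : R) : 0 <= l -> s <= - l -> truncation l s = - l.
Proof.
move=> l0 ls; rewrite /truncation.
have -> : Num.min s l = s by apply/min_idPl; lra.
exact/max_idPl.
Qed.

Lemma norm_truncationB_ge (k l s : R) : 0 < k -> 0 < l -> k + l <= `|s| ->
  l <= `|truncation l (s - truncation k s)|.
Proof.
move=> k0 l0; rewrite truncationB//; have [s0|s0] := leP 0 s.
  rewrite ger0_norm// => ks; rewrite !truncation_eqr; try lra.
  by have := ler_norm (k + l - k); lra.
rewrite ltr0_norm// => ks; rewrite !truncation_eql; try lra.
by rewrite ler_normr; apply/orP; right; lra.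
Qed.

Lemma truncationB_eq0 (k l s : R) : 0 < k -> 0 < l -> `|s| <= k ->
  truncation l (s - truncation k s) = 0.
Proof. by move=> k0 l0 sk; rewrite truncationB// !truncation_id ?subrr//; lra. Qed.

End truncations.

Lemma integral_EFin_Rintegral d (T : measurableType d) (R : realType)
    (mu : {measure set T -> \bar R}) (D : set T) (f : T -> R) : measurable D ->
  mu.-integrable D (EFin \o f) ->
  (\int[mu]_(x in D) (f x)%:E = (\int[mu]_(x in D) f x)%:E)%E.
Proof. by move=> mD fi; rewrite fineK//; exact: integrable_fin_num. Qed.

(** * Energy of the truncated solution *)

Section energy.
Context {R : realType} (n : nat) (Omega : set 'rV[R]_n).
Hypotheses (Omega_open : open Omega) (Omega_bounded : bounded_set Omega).
Local Notation sqi := (sqint leb Omega).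

Let mO : measurable Omega := rV_open_measurable Omega_open.
Let Ofin : (leb Omega < +oo)%E := bounded_leb_lty Omega_bounded.

(** The weak gradient equations are in the extended reals; square integrability makes all the
    integrals finite, so that the equations can be subtracted. *)
Lemma W12B (v w : 'rV[R]_n -> R) (G H : 'rV[R]_n -> 'rV[R]_n) :
  W12 Omega v G -> W12 Omega w H ->
  W12 Omega (fun x => v x - w x) (fun x => G x - H x).
Proof.
move=> [sv sG wG] [sw sH wH]; split.
- exact: (sqintB mO sv sw).
- move=> i; rewrite (_ : (fun _ => _) = (fun x => G x 0 i - H x 0 i)).
    exact: (sqintB mO (sG i) (sH i)).
  by apply/funext => x; rewrite !mxE.
move=> phi tphi i.
have sp := test_function_sqint Omega_open Omega_bounded tphi.
have sp' := test_function_sqint Omega_open Omega_bounded (test_function_partial i tphi).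
have i1 := sqintM mO sv sp'; have i2 := sqintM mO sw sp'.
have i3 := sqintM mO (sG i) sp; have i4 := sqintM mO (sH i) sp.
have E1 := wG _ tphi i; have E2 := wH _ tphi i.
rewrite (integral_EFin_Rintegral mO i1) (integral_EFin_Rintegral mO i3) -EFinN in E1.
rewrite (integral_EFin_Rintegral mO i2) (integral_EFin_Rintegral mO i4) -EFinN in E2.
case: E1 => E1; case: E2 => E2.
transitivity ((\int[leb]_(x in Omega) (v x * partial i phi x - w x * partial i phi x))%:E).
  rewrite -integral_EFin_Rintegral//; last exact: integrableBR.
  by apply: eq_integral => x _; rewrite mulrBl.
rewrite RintegralB// E1 E2.
transitivity (- (\int[leb]_(x in Omega) (G x 0 i * phi x - H x 0 i * phi x))%:E)%E.
  by rewrite RintegralB// -EFinN; congr EFin; ring.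
congr (- _)%E; rewrite -integral_EFin_Rintegral//; last exact: integrableBR.
by apply: eq_integral => x _; rewrite !mxE mulrBl.
Qed.

Lemma gradient_level_set v G (c : R) : W0_approx Omega v G ->
  {ae leb, forall x, Omega x -> v x = c -> G x = 0}.
Proof.
move=> W.
have H i := W0_approx_gradient_level_set Omega_open Omega_bounded c i W.
have : {ae leb, forall x, forall i, Omega x -> v x = c -> G x 0 i = 0}.
  exact: (@filter_forall _ _ (fun (i : 'I_n) x => Omega x -> v x = c -> G x 0 i = 0)).
by apply: filterS => x Hx Ox vc; apply/rowP => i; rewrite mxE; exact: Hx.
Qed.

Variables (a : 'rV[R]_n -> R -> R) (f u : 'rV[R]_n -> R) (alpha beta theta : R).
Hypotheses (alpha_gt0 : 0 < alpha) (theta_ge0 : 0 <= theta).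
Hypothesis a_bounds : {ae leb, forall x, Omega x -> forall s,
  alpha / (1 + `|s|) `^ theta <= a x s <= beta}.
Hypothesis mf : measurable_fun Omega f.
Hypothesis u_sol : entropy_solution Omega a f u.

Lemma truncation_energy (k l B : R) : 0 < k -> 0 < l ->
  (\int[leb]_(x in Omega `&` [set x | k <= `|u x|]%R) (`|f x|)%:E <= B%:E)%E ->
  exists G, [/\ W0_approx Omega (fun x => truncation l (u x - truncation k (u x))) G,
    {ae leb, forall x, Omega x -> `|u x| < k -> G x = 0} &
    \sum_(i < n) \int[leb]_(x in Omega) G x 0 i ^+ 2 <=
      (1 + k + l) `^ theta / alpha * (l * B)].
Proof.
move=> k0 l0 HB; have [mu trW [Du [mDu gDu] ineq]] := u_sol.
have kl0 : 0 < k + l by rewrite addr_gt0.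
have [Gk WGk AGk] := W012_approx Omega_open Omega_bounded (trW k k0).
have [Gl WGl AGl] := W012_approx Omega_open Omega_bounded (trW (k + l) kl0).
pose G x := Gl x - Gk x; exists G.
have wE : (fun x => truncation l (u x - truncation k (u x))) =
    (fun x => truncation (k + l) (u x) - truncation k (u x)).
  by apply/funext => x; exact: truncationB.
have AG : W0_approx Omega (fun x => truncation l (u x - truncation k (u x))) G.
  by rewrite wE; exact: W0_approxB.
have WG : W12 Omega (fun x => truncation l (u x - truncation k (u x))) G.
  by rewrite wE; exact: W12B.
(* [gDu] identifies Du only where |u| < k or |u| < k + l. Elsewhere the corresponding truncation
   takes one of two constant values, and its gradient vanishes there. *)
have ae1 := gDu _ k0 _ WGk; have ae2 := gDu _ kl0 _ WGl.
have ae3 := gradient_level_set k AGk; have ae4 := gradient_level_set (- k) AGk.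
have ae5 := gradient_level_set (k + l) AGl; have ae6 := gradient_level_set (- (k + l)) AGl.
have Gk0 : {ae leb, forall x, Omega x -> k <= `|u x| -> Gk x = 0}.
  apply: filterS2 ae3 ae4 => x H1 H2 Ox; rewrite ler_normr => /orP[ku|ku].
    by apply: H1 => //; apply: truncation_eqr => //; exact: ltW.
  by apply: H2 => //; apply: truncation_eql; [exact: ltW|lra].
have Gl0 : {ae leb, forall x, Omega x -> k + l <= `|u x| -> Gl x = 0}.
  apply: filterS2 ae5 ae6 => x H1 H2 Ox; rewrite ler_normr => /orP[ku|ku].
    by apply: H1 => //; apply: truncation_eqr => //; exact: ltW.
  by apply: H2 => //; apply: truncation_eql; [exact: ltW|lra].
have Gu : {ae leb, forall x, Omega x -> `|u x| < k -> G x = 0}.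
  apply: filterS2 ae1 ae2 => x H1 H2 Ox uk; rewrite /G -H1// -H2// ?subrr//; lra.
split => //.
have sG : forall i, sqi (fun x => G x 0 i) by case: AG.
pose c := alpha / (1 + k + l) `^ theta.
have kl1 : 0 < 1 + k + l by lra.
have c0 : 0 < c by rewrite divr_gt0// powR_gt0.
pose S x := \sum_(i < n) G x 0 i ^+ 2.
have S0 x : 0 <= S x by apply: sumr_ge0 => i _; exact: sqr_ge0.
have iS : leb.-integrable Omega (EFin \o S).
  rewrite (_ : EFin \o S = (fun x => \sum_(i < n) (EFin \o (fun x => G x 0 i ^+ 2)%R) x)%E).
    by apply: integrable_sum => // i _; exact: (sG i).2.
  by apply/funext => x /=; rewrite sumEFin.
have icS : leb.-integrable Omega (EFin \o (fun x => c * S x)) by exact: integrableZR.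
have aeD : {ae leb, forall x, Omega x -> k <= `|u x| -> `|u x| < k + l -> Du x = G x}.
  by apply: filterS2 Gk0 ae2 => x H1 H2 Ox ku ul; rewrite /G H1// subr0 H2.
have aeO : {ae leb, forall x, Omega x -> k + l <= `|u x| -> G x = 0}.
  apply: filterS2 Gk0 Gl0 => x H1 H2 Ox ku; rewrite /G H1// ?H2// ?subr0//; lra.
(* This dichotomy bounds the flux term below: either a is at least alpha / (1 + k + l)^theta and Du
   . G = |G|^2, or both sides vanish. *)
have aeG : {ae leb, forall x, Omega x -> (`|u x| < k + l /\ Du x = G x) \/ G x = 0}.
  apply: filterS3 Gu aeD aeO => x H1 H2 H3 Ox.
  have [ku|ku] := leP k `|u x|; last by right; exact: H1.
  have [ul|ul] := leP (k + l) `|u x|; first by right; exact: H3.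
  by left; split => //; exact: H2.
have aeF : {ae leb, forall x, Omega x ->
    ((c * S x)%:E <= (a x (u x) * dotp (Du x) (G x))%:E)%E}.
  apply: filterS2 aeG a_bounds => x HG Ha Ox; rewrite lee_fin.
  case: (HG Ox) => [[ul ->]|G0].
    have -> : dotp (G x) (G x) = S x by apply: eq_bigr => i _; rewrite expr2.
    apply: ler_wpM2r => //; have /andP[+ _] := Ha Ox (u x); apply: le_trans.
    rewrite /c ler_pM2l// lef_pV2 ?posrE ?powR_gt0// ?ltr_pwDl//.
    by apply: ge0_ler_powR; rewrite ?nnegrE ?addr_ge0// ?ltW//; lra.
  have -> : S x = 0 by rewrite /S big1// => i _; rewrite G0 mxE expr0n.
  by rewrite /dotp big1 ?mulr0// => i _; rewrite G0 mxE mulr0.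
have mcS : measurable_fun Omega (EFin \o (fun x => c * S x)) by exact: measurable_int icS.
have := ae_le_integral_nonmeasurable mO mcS (fun x _ => mulr_ge0 (ltW c0) (S0 x)) aeF.
have phiL : Linfty Omega (fun x => truncation k (u x)).
  split; first by case: AGk => -[].
  by exists k; apply: aeW => x _; apply: truncation_bound; exact: ltW.
move=> /le_trans /(_ (ineq l _ l0 (trW k k0) phiL G WG)).
have mT : measurable_fun Omega (fun x => truncation l (u x - truncation k (u x))).
  by case: AG => -[].
have mfT := measurable_funM mf mT.
(* The test function is bounded by l and vanishes where |u| < k, so only the integral of |f| over
   {|u| >= k} enters. *)
have HR : (\int[leb]_(x in Omega) (f x * truncation l (u x - truncation k (u x)))%:E <=
    (l * B)%:E)%E.
  apply: le_trans (lee_abs _) _.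
  apply: le_trans (le_abse_integral leb mO _) _; first exact/measurable_EFinP.
  pose P : set 'rV[R]_n := [set x | k <= `|u x|].
  pose g (x : 'rV[R]_n) : \bar R := (l%:E * (`|f x|)%:E)%E.
  have HP : (\int[leb]_(x in Omega) `|(f x * truncation l (u x - truncation k (u x)))%:E| <=
      \int[leb]_(x in Omega) (g \_ P) x)%E.
    apply: ge0_le_integral_nonmeasurable => x Ox; first exact: abse_ge0.
    rewrite patchE; case: ifPn => [_|]; last first.
      rewrite notin_setE /P /= => /negP; rewrite -ltNge => /ltW uk.
      by rewrite truncationB_eq0// mulr0 normr0.
    rewrite /g -EFinM lee_fin normrM mulrC ler_wpM2r//.
    by apply: truncation_bound; exact: ltW.
  apply: (le_trans HP).
  rewrite -integral_mkcondr ge0_integralZl_EFin//; first last.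
  - exact: ltW.
  - apply/measurable_EFinP; apply: measurableT_comp => //.
    by apply: measurable_funS mf => // x [].
  - exact: measurable_superlevel.
  by rewrite EFinM lee_pmul2l.
move=> /le_trans /(_ HR).
rewrite (integral_EFin_Rintegral mO icS) RintegralZl// lee_fin => HcS.
have -> : \sum_(i < n) \int[leb]_(x in Omega) G x 0 i ^+ 2 = \int[leb]_(x in Omega) S x.
  apply: EFin_inj; rewrite -(integral_EFin_Rintegral mO iS) -sumEFin.
  rewrite [RHS](_ : _ = (\int[leb]_(x in Omega) (\sum_(i < n)
    (EFin \o (fun x => G x 0 i ^+ 2)%R) x))%E).
    rewrite integral_sum//; last by move=> i; exact: (sG i).2.
    by apply: eq_bigr => i _; rewrite -integral_EFin_Rintegral//; exact: (sG i).2.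
  by apply: eq_integral => x _; rewrite /= sumEFin.
rewrite -(ler_pM2l c0); apply: le_trans HcS _.
rewrite le_eqVlt; apply/orP; left; apply/eqP; rewrite /c.
by set Z := _ `^ _; field; rewrite !gt_eqF ?powR_gt0.
Qed.

End energy.

(** * Decay of superlevel sets and weak Lebesgue bounds *)

Section decay.
Context {R : realType} (n : nat) (Omega : set 'rV[R]_n).
Hypotheses (Omega_open : open Omega) (Omega_bounded : bounded_set Omega).
Variable u : 'rV[R]_n -> R.
Hypothesis mu : measurable_fun Omega u.

Let mO : measurable Omega := rV_open_measurable Omega_open.
Let Ofin : (leb Omega < +oo)%E := bounded_leb_lty Omega_bounded.

Definition superlevel (k : R) : set 'rV[R]_n := Omega `&` [set x | k <= `|u x|].

Lemma measurable_superlevel_set k : measurable (superlevel k).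
Proof. exact: measurable_superlevel. Qed.

Lemma leb_sub_fin_num (A : set 'rV[R]_n)
  : measurable A -> A `<=` Omega -> leb A \is a fin_num.
Proof.
move=> mA AO; rewrite ge0_fin_numE//; apply: le_lt_trans Ofin.
by apply: le_measure; rewrite ?inE.
Qed.

Lemma fine_leb_le (A B : set 'rV[R]_n) : measurable A -> measurable B -> A `<=` B ->
  B `<=` Omega -> fine (leb A) <= fine (leb B).
Proof.
move=> mA mB AB BO; apply: fine_le.
- by apply: leb_sub_fin_num => //; exact: subset_trans AB BO.
- exact: leb_sub_fin_num.
- by apply: le_measure; rewrite ?inE.
Qed.

Lemma superlevel_anti (k l : R) : k <= l ->
  fine (leb (superlevel l)) <= fine (leb (superlevel k)).
Proof.
move=> kl; apply: fine_leb_le; try exact: measurable_superlevel_set.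
  by move=> x [Ox /= lu]; split => //=; exact: le_trans lu.
exact: subIsetl.
Qed.

(** Both {|w| >= k / 8} and, up to a null set, the support of G lie in {|u| >= k}. The first gives
    the hypothesis of the superlevel estimate, the second allows Young's inequality against the
    indicator of that set. *)
Lemma superlevel_step (k S : R) (w : 'rV[R]_n -> R) (G : 'rV[R]_n -> 'rV[R]_n) : 0 < k ->
  (forall x, 2 * k <= `|u x| -> k <= `|w x|) ->
  (forall x, `|u x| <= k -> w x = 0) ->
  W0_approx Omega w G ->
  {ae leb, forall x, Omega x -> `|u x| < k -> G x = 0} ->
  \sum_(i < n) \int[leb]_(x in Omega) G x 0 i ^+ 2 <= S ->
  forall t r, 0 < t -> 0 < r -> 4 * fine (leb (superlevel k)) < r ^+ n ->
  k / 8 * fine (leb (superlevel (2 * k))) <=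
  r * (n%:R * (t * fine (leb (superlevel k))) + t^-1 * S).
Proof.
move=> k0 w1 w2 AG G0 GS t r t0 r0 Hr; have [sw sG _] := AG.
have mB k' := measurable_superlevel_set k'.
have k80 : 0 < k / 8 by rewrite divr_gt0.
have H1 : 4 * fine (leb (Omega `&` [set x | k / 8 <= `|w x|])) < r ^+ n.
  apply: le_lt_trans Hr; rewrite ler_pM2l//; apply: fine_leb_le => //.
  - exact: measurable_superlevel sw.1.
  - move=> x [Ox /= kw]; split => //=; rewrite leNgt; apply/negP => /ltW /w2 w0.
    by move: kw; rewrite w0 normr0 leNgt k80.
  - exact: subIsetl.
have := W0_approx_superlevel_le Omega_open Omega_bounded AG k0 r0 H1.
move=> H2; apply: (@le_trans _ _ (k / 8 * fine (leb (Omega `&` [set x | k <= `|w x|])))).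
  rewrite ler_pM2l//; apply: fine_leb_le => //.
  - exact: measurable_superlevel sw.1.
  - by move=> x [Ox /= ku]; split => //=; exact: w1.
apply: le_trans H2 _; rewrite ler_pM2l//.
pose I (x : 'rV[R]_n) : R := \1_(superlevel k) x.
have sI : sqint leb Omega I.
  apply: (sqint_bounded mO Ofin (K := 1)).
    by apply: measurable_funTS; exact: measurable_indic.
  by move=> x _; rewrite /I indicE; case: (_ \in _); rewrite ?normr1 ?normr0.
have I2 : \int[leb]_(x in Omega) I x ^+ 2 = fine (leb (superlevel k)).
  rewrite /Rintegral; congr fine.
  transitivity (\int[leb]_(x in Omega) (\1_(superlevel k) x)%:E)%E.
    apply: eq_integral => x _; rewrite /I indicE; congr EFin.
    by case: (_ \in _); rewrite ?expr1n ?expr0n.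
  rewrite integral_indic//; congr (leb _); apply: setIidl; exact: subIsetl.
have HG i : \int[leb]_(x in Omega) `|G x 0 i| <=
    t * fine (leb (superlevel k)) + t^-1 * \int[leb]_(x in Omega) G x 0 i ^+ 2.
  rewrite -I2; apply: le_trans (Rintegral_young mO t0 sI (sG i)).
  rewrite le_eqVlt; apply/orP; left; apply/eqP.
  have iIG := integrable_normR (sqintM mO sI (sG i)).
  have iG := integrable_normR (sqint_integrable mO Ofin (sG i)).
  have m1 : measurable_fun Omega (EFin \o (fun x => `|G x 0 i|))
    by exact: measurable_int iG.
  have m2 : measurable_fun Omega (EFin \o (fun x => `|I x * G x 0 i|)).
    exact: measurable_int iIG.
  rewrite /Rintegral; congr fine; apply: (@ae_eq_integral _ _ _ leb Omega _ _ mO m1 m2).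
  - apply: filterS G0 => x Gx Ox; congr EFin; rewrite /I indicE.
    have [/set_mem ?|] := boolP (x \in superlevel k); first by rewrite mul1r.
    rewrite notin_setE => nx; rewrite mul0r normr0 Gx ?mxE ?normr0//.
    by rewrite ltNge; apply/negP => ku; apply: nx.
apply: le_trans (ler_sum _ (fun i _ => HG i)) _.
rewrite big_split /= sumr_const card_ord -mulr_sumr; apply: lerD.
  by rewrite mulr_natl.
by rewrite ler_pM2l// invr_gt0.
Qed.

Lemma weakL_dyadic (s M : R) : 0 < s -> 0 <= M ->
  (forall j, fine (leb (superlevel (2 ^+ j))) <= M * (2 ^+ j) `^ (- s)) ->
  weakL Omega s u.
Proof.
move=> s0 M0 HM; split => //.
pose V := fine (leb Omega).
have V0 : 0 <= V by exact: fine_ge0.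
(* V serves for lambda < 1; otherwise lambda is rounded down to a power of 2, at the cost of a
   factor 2^s. *)
exists (V + M * 2 `^ s) => lambda l0.
have mA : measurable (Omega `&` [set x | lambda < `|u x|]).
  rewrite (_ : [set x | _] = (fun x => `|u x|) @^-1` `]lambda, +oo[%classic).
    have mnu : measurable_fun Omega (fun x => `|u x|) by exact: measurableT_comp.
    exact: mnu.
  by apply/seteqP; split => x /=; rewrite in_itv /= andbT.
rewrite -(fineK (leb_sub_fin_num mA _)); last exact: subIsetl.
rewrite lee_fin ler_pdivlMr ?powR_gt0//.
have M20 : 0 <= M * 2 `^ s by rewrite mulr_ge0// powR_ge0.
have [l1|l1] := ltP lambda 1.
  apply: (@le_trans _ _ (V * 1)); last by rewrite mulr1 lerDl.
  apply: ler_pM; rewrite ?fine_ge0 ?powR_ge0//.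
    by apply: fine_leb_le => //; exact: subIsetl.
  rewrite [leRHS](_ : 1 = 1 `^ s); last by rewrite powR1.
  by apply: ge0_ler_powR; rewrite ?nnegrE ?ltW.
have [j /andP[j1 j2]] : exists j : nat, 2 ^+ j <= lambda < 2 ^+ j.+1.
  have [j0 Hj0] := dyadic_le lambda.
  have ex : exists j, lambda < 2 ^+ j.
    by exists j0.+1; apply: le_lt_trans Hj0 _; rewrite exprS ltr_pMl ?exprn_gt0// ltr1n.
  case: (ex_minnP ex) => -[|j] lj min; first by rewrite expr0 ltNge l1 in lj.
  exists j; rewrite lj andbT leNgt; apply/negP => /min; by rewrite ltnn.
have x0 : (0 : R) < 2 ^+ j by rewrite exprn_gt0.
apply: (@le_trans _ _ (M * (2 ^+ j) `^ (- s) * (2 ^+ j.+1) `^ s)).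
  apply: ler_pM; rewrite ?fine_ge0 ?powR_ge0//.
    apply: le_trans (HM j); apply: fine_leb_le => //.
    + exact: measurable_superlevel_set.
    + by move=> x [Ox /= lu]; split => //=; apply: le_trans j1 (ltW lu).
    + exact: subIsetl.
  by apply: ge0_ler_powR; rewrite ?nnegrE ?exprn_ge0// ltW.
rewrite exprS powRM ?(ltW x0)// powRN.
rewrite [leLHS](_ : _ = M * 2 `^ s); first by rewrite lerDr.
by field; rewrite gt_eqF// powR_gt0.
Qed.

End decay.

Theorem theorem2p2 (R : realType) (n : nat) (Omega : set 'rV[R]_n)
    (theta alpha beta m : R) (a : 'rV[R]_n -> R -> R) (f u : 'rV[R]_n -> R)
    (n_gt2 : (2 < n)%N)
    (Omega_open : open Omega) (Omega_bounded : bounded_set Omega)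
    (theta_ge0 : 0 <= theta) (theta_lt1 : theta < 1)
    (alpha_gt0 : 0 < alpha) (beta_gt0 : 0 < beta)
    (a_caratheodory : caratheodory_function Omega a)
    (a_bounds : {ae leb, forall x, Omega x -> forall s,
       alpha / (1 + `|s|) `^ theta <= a x s <= beta})
    (m_gt1 : 1 < m) (m_lt : m < sobolev_exponent_conj n)
    (f_weakL : weakL Omega m f)
    (u_sol : entropy_solution Omega a f u) :
  weakL Omega (mstarstar n m * (1 - theta)) u.
Proof.
have [mf [gamma fg]] := f_weakL; have [mu _ _] := u_sol.
have mO := rV_open_measurable Omega_open.
have n2 : (2 : R) < n%:R by rewrite ltr_nat.
(* m (n + 2) < 2 n together with m n > n gives n + 2 m < 2 n. *)
have nm : 2 * m < n%:R.
  have : m * (n%:R + 2) < 2 * n%:R.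
    by rewrite -ltr_pdivlMr; [exact: m_lt|lra].
  nra.
have n0 : (0 < n)%N by exact: ltn_trans n_gt2.
pose q := 1 + n%:R^-1 - (2 * m)^-1.
pose s := mstarstar n m * (1 - theta).
have m0 : 0 < m by lra.
have nR0 : (0 : R) < n%:R by lra.
have nm0 : 0 < n%:R - 2 * m by lra.
have q0 : 0 < q.
  have : (2 * m)^-1 < 1 by rewrite invf_lt1; lra.
  have : (0 : R) < n%:R^-1 by rewrite invr_gt0.
  rewrite /q; lra.
have q1 : q < 1.
  have : (n%:R : R)^-1 < (2 * m)^-1 by rewrite ltf_pV2 ?posrE//; lra.
  rewrite /q; lra.
have sq : s * (1 - q) = (1 - theta) / 2.
  rewrite /s /q /mstarstar; field.
  by rewrite !gt_eqF.
have s0 : 0 < s.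
  by rewrite mulr_gt0 ?subr_gt0// divr_gt0// mulr_gt0.
have gamma0 : 0 <= gamma.
  have := fg 1 ltr01; rewrite powR1 divr1 => /(le_trans (measure_ge0 _ _)).
  by rewrite lee_fin.
pose rho : R := 2 `^ (1 - m).
have rho1 : rho < 1 by rewrite /rho /powR gt_eqF// expR_lt1 nmulr_rlt0 ?subr_lt0//
  ln_gt0// ltr1n.
pose Cf := 1 + 2 * gamma / (1 - rho).
have Cf0 : 0 < Cf by rewrite /Cf ltr_pwDl// divr_ge0 ?mulr_ge0//; lra.
(* The energy factor (1 + k + l)^theta with l = k is at most (3 k)^theta for k >= 1. *)
pose A := 3 `^ theta * Cf / alpha.
have A0 : 0 <= A by rewrite divr_ge0 ?mulr_ge0 ?powR_ge0// ltW.
pose C := 8 * 5 `^ n%:R^-1 * (n%:R + A).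
have C0 : 0 <= C by rewrite !mulr_ge0 ?powR_ge0// addr_ge0// ltW.
have step k : 1 <= k -> fine (leb (superlevel Omega u (2 * k))) <=
    C * k `^ (- ((1 - theta) / 2)) * fine (leb (superlevel Omega u k)) `^ q.
  move=> k1; have k0 : 0 < k by lra.
  have mB := measurable_superlevel_set Omega_open mu k.
  have BO : superlevel Omega u k `<=` Omega by exact: subIsetl.
  have fB := leb_sub_fin_num Omega_open Omega_bounded mB BO.
  set b := fine (leb (superlevel Omega u k)).
  (* If {|u| >= k} is null, so is {|u| >= 2k}; otherwise negative powers of b are meaningful. *)
  have [b0|b0] := leP b 0.
    apply: (@le_trans _ _ b); last apply: le_trans b0 _.
      by apply: superlevel_anti => //; lra.
    by apply: mulr_ge0; [apply: mulr_ge0 => //|]; exact: powR_ge0.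
  have Eb : leb (superlevel Omega u k) = b%:E by rewrite fineK.
  (* At the cutoff l = b^(-1/m) both l b and l^(1 - m) equal b^(1 - 1/m), which balances the two
     parts of the bound on the integral of |f|. *)
  have lk0 : 0 < b `^ (- m^-1) by rewrite powR_gt0.
  have HF := weak_integral_dyadic mO m_gt1 mf gamma0 fg mB BO Eb lk0.
  have E1 : b `^ (- m^-1) * b = b `^ (1 - m^-1).
    rewrite [in RHS]addrC powRD; first by rewrite powRr1// ltW.
    by rewrite (gt_eqF b0) implybT.
  have E2 : (b `^ (- m^-1)) `^ (1 - m) = b `^ (1 - m^-1).
    by rewrite -powRrM; congr (_ `^ _); field; rewrite gt_eqF.
  have EB : b `^ (- m^-1) * b + 2 * gamma * (b `^ (- m^-1)) `^ (1 - m)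
    / (1 - 2 `^ (1 - m)) =
      Cf * b `^ (1 - m^-1).
    by rewrite E1 E2 /Cf -/rho; field; rewrite gt_eqF// subr_gt0.
  rewrite EB in HF.
  have [G [AG G0 GS]] := truncation_energy Omega_open Omega_bounded alpha_gt0 theta_ge0
    a_bounds mf u_sol k0 k0 HF.
  apply: (balance_exponents n0 m0 theta_ge0 k1 b0 A0
    (S := \sum_(i < n) \int[leb]_(x in Omega) G x 0 i ^+ 2)).
    apply: le_trans GS _.
    rewrite [leRHS](_ : _ = (3 * k) `^ theta / alpha * (k * (Cf * b `^ (1 - m^-1))));
      last first.
      rewrite powRM ?(ltW k0)// powRD; last by rewrite (gt_eqF k0) implybT.
      rewrite powRr1 ?(ltW k0)// /A.
      by set X := b `^ _; set Y := k `^ _; set Z := 3 `^ _; field; rewrite gt_eqF.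
    apply: ler_wpM2r; first by rewrite !mulr_ge0 ?powR_ge0// ltW.
    rewrite ler_pM2r ?invr_gt0//; apply: ge0_ler_powR; rewrite ?nnegrE//; lra.
  apply: (superlevel_step Omega_open Omega_bounded mu k0 _ _ AG G0 (lexx _)).
    by move=> x ku; apply: norm_truncationB_ge => //; lra.
  by move=> x ku; exact: truncationB_eq0.
have [||||M M0 HM] := @dyadic_decay R (fun j => fine (leb (superlevel Omega u (2 ^+ j))))
  C (fine (leb Omega)) s q C0 _ _ _ _.
- by rewrite q0 q1.
- exact: fine_ge0.
- move=> j; rewrite fine_ge0//=.
  have mj := measurable_superlevel_set Omega_open mu (2 ^+ j).
  by apply: (fine_leb_le Omega_open Omega_bounded mj mO) => //; exact: subIsetl.
- move=> j; rewrite sq exprS; apply: step.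
  by rewrite -natrX ler1n expn_gt0.
exact: (weakL_dyadic Omega_open Omega_bounded mu s0 M0 HM).
Qed.
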